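(* Let $G\in \mathcal{E}_c$, let $\mathcal{A}$ be an $S$-ring over $G$, and let $S=U/L$ be an $\mathcal{A}$-section of $G$. Suppose that $\mathcal{A}$ is the nontrivial $S$-wreath product and that the $S$-rings $\mathcal{A}_U$ and $\mathcal{A}_{G/L}$ are CI-$S$-rings. Then $\mathcal{A}$ is a CI-$S$-ring whenever $$\mathrm{Aut}_{S}(\mathcal{A}_{S})=\mathrm{Aut}_U(\mathcal{A}_U)^{S}\,\mathrm{Aut}_{G/L}(\mathcal{A}_{G/L})^{S}.$$ In particular, $\mathcal{A}$ is a CI-$S$-ring if $\mathrm{Aut}_{S}(\mathcal{A}_{S})=\mathrm{Aut}_U(\mathcal{A}_U)^{S}$ or $\mathrm{Aut}_{S}(\mathcal{A}_{S})=\mathrm{Aut}_{G/L}(\mathcal{A}_{G/L})^{S}$.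
   Context: $\mathcal{E}_c$ is the class of all finite abelian groups each of whose Sylow subgroups is elementary abelian or isomorphic to $C_4$ (the cyclic group of order 4). $S$-rings. Let $G$ be a finite group with identity $e$; for $X\subseteq G$ put $\underline{X}=\sum_{x\in X}x\in\mathbb{Z}G$ and $\mathrm{rad}(X)=\{g\in G: gX=Xg=X\}$. A subring $\mathcal{A}\le\mathbb{Z}G$ is an $S$-ring over $G$ if there is a partition $\mathcal{S}(\mathcal{A})$ of $G$ such that $\{e\}\in\mathcal{S}(\mathcal{A})$, $X\in\mathcal{S}(\mathcal{A})$ implies $X^{-1}\in\mathcal{S}(\mathcal{A})$, and $\mathcal{A}=\mathrm{Span}_{\mathbb{Z}}\{\underline{X}:X\in\mathcal{S}(\mathcal{A})\}$. The elements of $\mathcal{S}(\mathcal{A})$ are the basic sets of $\mathcal{A}$. An $\mathcal{A}$-subgroup is a subgroup $H\le G$ with $\underline{H}\in\mathcal{A}$. An $\mathcal{A}$-section is a section $S=U/L$ ($L\trianglelefteq U\le G$) with $U$ and $L$ $\mathcal{A}$-subgroups; then $\mathcal{A}_S=\mathrm{Span}_{\mathbb{Z}}\{\underline{X^{\pi}}:X\in\mathcal{S}(\mathcal{A}),X\subseteq U\}$, with $\pi:U\to U/L$ the canonical epimorphism, is an $S$-ring over $S$ (its basic sets are the $X^\pi$). In particular $\mathcal{A}_U$ and $\mathcal{A}_{G/L}$ are defined. Isomorphisms and CI-$S$-rings. Let $R(X)=\{(g,xg):x\in X,\ g\in G\}$. A bijection $f:G\to G'$ is an isomorphism from an $S$-ring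 $\mathcal{A}$ over $G$ to an $S$-ring $\mathcal{A}'$ over $G'$ if $\{R(X)^f:X\in\mathcal{S}(\mathcal{A})\}=\{R(X'):X'\in\mathcal{S}(\mathcal{A}')\}$, where $R(X)^f=\{(g^f,h^f):(g,h)\in R(X)\}$. Let $\mathrm{Iso}(\mathcal{A})$ be the set of all $f\in\mathrm{Sym}(G)$ that are isomorphisms from $\mathcal{A}$ onto some $S$-ring over $G$, let $\mathrm{Aut}(\mathcal{A})=\{f\in\mathrm{Sym}(G): R(X)^f=R(X)\text{ for every }X\in\mathcal{S}(\mathcal{A})\}$, and $\mathrm{Aut}_G(\mathcal{A})=\mathrm{Aut}(\mathcal{A})\cap\mathrm{Aut}(G)$. $\mathcal{A}$ is a CI-$S$-ring if $\mathrm{Aut}(\mathcal{A})\,\mathrm{Aut}(G)=\mathrm{Iso}(\mathcal{A})$. For a set $\Delta$ of permutations and a section $S=U/L$, $\Delta^S=\{f^S: f\in\Delta,\ S^f=S\}$, where $S^f=S$ means that $f$ permutes the $L$-cosets in $U$ and $f^S$ is the induced bijection of $S$; for a set of permutations of $G/L$, $S=U/L$ is regarded as a subgroup of $G/L$. Generalized wreath product. $\mathcal{A}$ is the $S$-wreath product for an $\mathcal{A}$-section $S=U/L$ if $L\trianglelefteq G$ and $L\le\mathrm{rad}(X)$ for each basic set $X$ of $\mathcal{A}$ lying outside $U$. It is called nontrivial if $L\ne\{e\}$ and $U\ne G$. *)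

(* Defs.v *)
From HB Require Import structures.
From mathcomp Require Import all_boot all_order all_algebra all_fingroup all_solvable.
Set Implicit Arguments.
Unset Strict Implicit.
Unset Printing Implicit Defensive.
Import GroupScope GRing.Theory.

(* The integral group ring: functions gT -> int under convolution. *)
Definition zgroup (gT : finGroupType) : Type := {ffun gT -> int}.

Section GroupRing.
Variable gT : finGroupType.
Local Open Scope ring_scope.

HB.instance Definition _ := GRing.Zmodule.copy (zgroup gT) {ffun gT -> int}.

Definition zg_one : zgroup gT := [ffun g => (g == 1%g)%:R].
Definition zg_mul (a b : zgroup gT) : zgroup gT :=
  [ffun g => \sum_h a h * b (h^-1 * g)%g].

Fact zg_mulA : associative zg_mul.
Proof.
move=> a b c; apply/ffunP=> g; rewrite !ffunE.
under eq_bigr => h _ do rewrite ffunE mulr_sumr.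
under [RHS]eq_bigr => k _ do rewrite ffunE mulr_suml.
rewrite [RHS]exchange_big /=; apply: eq_bigr => h _.
rewrite [RHS](reindex_inj (mulgI h)) /=; apply: eq_bigr => k _.
by rewrite mulrA mulKg invMg mulgA.
Qed.

Fact zg_mul1 : left_id zg_one zg_mul.
Proof.
move=> a; apply/ffunP=> g; rewrite ffunE (bigD1 1%g) //= big1 => [|h /negPf h1].
  by rewrite ffunE eqxx mul1r invg1 mul1g addr0.
by rewrite ffunE h1 mul0r.
Qed.

Fact zg_mulr1 : right_id zg_one zg_mul.
Proof.
move=> a; apply/ffunP=> g; rewrite ffunE (bigD1 g) //= big1 => [|h hg].
  by rewrite ffunE mulVg eqxx mulr1 addr0.
by rewrite ffunE -eq_mulVg1 (negPf hg) mulr0.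
Qed.

Fact zg_mulDl : left_distributive zg_mul +%R.
Proof.
move=> a b c; apply/ffunP=> g; rewrite !ffunE -big_split /=.
by apply: eq_bigr => h _; rewrite ffunE mulrDl.
Qed.

Fact zg_mulDr : right_distributive zg_mul +%R.
Proof.
move=> a b c; apply/ffunP=> g; rewrite !ffunE -big_split /=.
by apply: eq_bigr => h _; rewrite ffunE mulrDr.
Qed.

Fact zg_one_neq0 : zg_one != 0.
Proof. by apply/eqP => /ffunP/(_ 1%g); rewrite !ffunE eqxx. Qed.

HB.instance Definition _ := GRing.Zmodule_isNzRing.Build (zgroup gT)
  zg_mulA zg_mul1 zg_mulr1 zg_mulDl zg_mulDr zg_one_neq0.

Definition zsum (X : {set gT}) : zgroup gT := [ffun g => (g \in X)%:R].

Definition zspan (P : {set {set gT}}) (a : zgroup gT) : Prop :=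
  exists c : {set gT} -> int, a = \sum_(X in P) zsum X *~ c X.

Definition is_subring (R : nzRingType) (A : R -> Prop) : Prop :=
  [/\ A 1, forall a b, A a -> A b -> A (a - b)
    & forall a b, A a -> A b -> A (a * b)].

End GroupRing.

(* An S-ring A over G is represented by the set P = S(A) of its basic sets;
   A itself is [zspan P], and the two determine each other. *)
Definition is_Sring (gT : finGroupType) (G : {set gT}) (P : {set {set gT}}) :
    Prop :=
  [/\ partition P G, [set 1] \in P, {in P, forall X : {set gT}, X^-1 \in P}
    & is_subring (zspan P)].

Definition is_Asubgroup (gT : finGroupType) (G : {set gT})
    (P : {set {set gT}}) (H : {group gT}) : Prop :=
  H \subset G /\ zspan P (zsum H).

Definition is_Asection (gT : finGroupType) (G : {set gT})
    (P : {set {set gT}}) (U L : {group gT}) : Prop :=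
  [/\ L <| U, is_Asubgroup G P U & is_Asubgroup G P L].

(* Basic sets of A_U, over U itself rather than over U / 1. *)
Definition Sring_sub (gT : finGroupType) (P : {set {set gT}})
    (U : {set gT}) : {set {set gT}} :=
  [set X in P | X \subset U].

(* Basic sets of A_{U/L}. *)
Definition Sring_sec (gT : finGroupType) (P : {set {set gT}})
    (U L : {set gT}) : {set {set coset_of L}} :=
  [set X / L | X : {set gT} in P & X \subset U].

Definition srad (gT : finGroupType) (G X : {set gT}) : {set gT} :=
  [set g in G | (g *: X == X) && (X :* g == X)].

Definition Rrel (gT : finGroupType) (G X : {set gT}) : {set gT * gT} :=
  [set (g, x * g) | x in X, g in G].

Definition rel_img (T : finType) (f : T -> T) (r : {set T * T}) : {set T * T} :=
  [set (f p.1, f p.2) | p in r].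

(* As for [Aut G], the elements of Sym(G) are the permutations of gT that fix
   every point outside G. *)
Definition in_Iso (gT : finGroupType) (G : {set gT}) (P : {set {set gT}})
    (f : {perm gT}) : Prop :=
  perm_on G f /\
  exists2 P' : {set {set gT}}, is_Sring G P' &
    [set rel_img f (Rrel G X) | X in P] = [set Rrel G X' | X' in P'].

Definition AutSr (gT : finGroupType) (G : {set gT}) (P : {set {set gT}}) :
    {set {perm gT}} :=
  [set f : {perm gT} | perm_on G f &
    [forall X in P, rel_img f (Rrel G X) == Rrel G X]].

(* Aut_G(A) *)
Definition AutG (gT : finGroupType) (G : {set gT}) (P : {set {set gT}}) :
    {set {perm gT}} :=
  AutSr G P :&: Aut G.

Definition is_CI (gT : finGroupType) (G : {set gT}) (P : {set {set gT}}) :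
    Prop :=
  forall f : {perm gT}, f \in AutSr G P * Aut G <-> in_Iso G P f.

(* Delta^{U/L} for Delta a set of permutations of a group containing U:
   h = f^{U/L} for some f in Delta that permutes the L-cosets in U. *)
Definition sec_perms (gT : finGroupType) (U L : {set gT})
    (Delta : {set {perm gT}}) : {set {perm coset_of L}} :=
  [set h : {perm coset_of L} | perm_on (U / L) h &
    [exists f in Delta,
      ([set f @: (C : {set gT}) | C in rcosets L U] == rcosets L U) &&
      [forall x in U, h (coset L x) == coset L (f x)]]].

(* Delta^H for a subgroup H, i.e. for the section H / 1 identified with H. *)
Definition sub_perms (gT : finGroupType) (H : {set gT})
    (Delta : {set {perm gT}}) : {set {perm gT}} :=
  [set restr_perm H f | f : {perm gT} in Delta & f @: H == H].

Definition is_wreath (gT : finGroupType) (G : {set gT}) (P : {set {set gT}})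
    (U L : {group gT}) : Prop :=
  L <| G /\
  {in P, forall X : {set gT}, X \subset G :\: U -> L \subset srad G X}.

Definition is_nontrivial_wreath (gT : finGroupType) (G : {set gT})
    (P : {set {set gT}}) (U L : {group gT}) : Prop :=
  [/\ is_wreath G P U L, L :!=: 1 & U :!=: G].

Definition in_Ec (gT : finGroupType) (G : {group gT}) : Prop :=
  abelian G /\
  forall (p : nat) (Q : {group gT}), prime p -> p.-Sylow(G) Q ->
    p.-abelem Q \/ Q \isog [set: 'Z_4].

(* Main.v *)
Require Import Defs.
From mathcomp Require Import all_boot all_order all_algebra all_fingroup all_solvable.
Import GroupScope.

Set Implicit Arguments.
Unset Strict Implicit.
Unset Printing Implicit Defensive.
Import GRing.Theory.

(** An isomorphism [f] of S-rings over [G] may be composed with a translation, so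
that it fixes the identity; it then sends each basic set [X] to [f @: X], and it
lies in [Aut(A) Aut(G)] as soon as some automorphism of [G] has the same image as
[f] on every basic set ([CI_intro], [CI_normal_iso]).  The CI property thus only
asks for such an automorphism.

Let [f] be normalized in this way.  The images [f @: U] and [f @: L] are
subgroups, of the same orders as [U] and [L]; groups whose Sylow subgroups are
elementary abelian or cyclic of order 4 have enough automorphisms to bring them
back to [U] and [L] ([Ec_transitive]), so one may assume that [f] preserves both.
Then [f] restricts to [U] and induces a permutation of [G / L], both normalized
isomorphisms ([normal_iso_restr], [normal_iso_quotient]), and the two CI
hypotheses give [phi1] in [Aut U] and [phi2] in [Aut (G / L)] with the right
images of basic sets.  The two need not agree on [U / L], but they differ there
by an automorphism fixing every basic set of [A_S].  Writing that automorphism as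
a product of automorphisms coming from [A_U] and [A_{G/L}] gives corrections
after which they do agree.

It remains to glue: a projectivity property of the same groups ([Ec_lift]) gives
an automorphism [phi] of [G] that extends [phi1] and induces [phi2].  It agrees
with [f] on the basic sets inside [U] by the choice of [phi1]; the remaining ones
are unions of [L]-cosets, hence are determined by their images in [G / L], where
[phi2] and [f] agree ([wreath_automorphism]).

Both facts about the group are proved on each primary component, by complements
in the elementary abelian case and by inspection for the cyclic group of order 4,
then assembled over the primes.  That the induced structures are again S-rings
follows from the description of the span of the basic sets as the functions that
are supported on the group and constant on basic sets ([zspanE]). *)

(** * The span of the basic sets *)

Section Span.
Variable gT : finGroupType.
Implicit Types (G : {group gT}) (P : {set {set gT}}) (a b : zgroup gT).

(** The value at [g] of an integral combination of simple quantities. *)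
Lemma zsum_eval P (c : {set gT} -> int) (g : gT) :
  ((\sum_(X in P) zsum X *~ c X)%R : zgroup gT) g
    = (\sum_(X in P) (g \in X)%:R * c X)%R.
Proof.
pose ev (a : zgroup gT) := a g.
have evM a z : ev (a *~ z)%R = (ev a *~ z)%R.
  have evMn n : ev (a *+ n)%R = (ev a *+ n)%R.
    elim: n => [|n IH]; first by rewrite !mulr0n /ev ffunE.
    by rewrite !mulrS -IH /ev ffunE.
  case: z => n; first exact: evMn.
  by rewrite NegzE !mulrNz /ev ffunE -!pmulrn; congr (- _)%R; exact: evMn.
change (ev (\sum_(X in P) zsum X *~ c X)%R = (\sum_(X in P) (g \in X)%:R * c X)%R).
rewrite (big_morph ev (id1 := 0%R) (op1 := +%R)) /ev ?ffunE //.
  by apply: eq_bigr => X _; rewrite -/(ev _) evM /ev ffunE -mulrzr intz.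
by move=> u v; rewrite ffunE.
Qed.

(** The span of the simple quantities of a partition of [D] consists of the
   functions supported on [D] and constant on each class. *)
Lemma zspanE P (D : {set gT}) a : partition P D ->
  zspan P a <->
  (forall g, g \notin D -> a g = 0%R) /\
  {in P, forall X : {set gT}, {in X &, forall x y, a x = a y}}.
Proof.
move=> partP; have [/eqP covP tiP notP0] := and3P partP; split.
  case=> c ->{a}; split=> [g Dg | X PX x y Xx Xy].
    rewrite zsum_eval big1 // => X PX.
    case Xg: (g \in X); last by rewrite mul0r.
    by case/negP: Dg; rewrite -covP; apply/bigcupP; exists X.
  rewrite !zsum_eval; apply: eq_bigr => Y PY; congr (_%:R * _)%R.
  suff memE z : z \in X -> (z \in Y) = (X == Y) by rewrite !memE.
  move=> Xz; apply/idP/eqP => [Yz | <- //].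
  by rewrite -(def_pblock tiP PX Xz) (def_pblock tiP PY Yz).
case=> a0 aP; exists (fun X => a (repr X)); apply/ffunP=> g; rewrite zsum_eval.
have [Dg | /a0 ag0] := boolP (g \in D); last first.
  rewrite ag0 big1 // => X PX; case Xg: (g \in X); last by rewrite mul0r.
  by rewrite (aP X PX (repr X) g) ?ag0 ?mulr0 // (mem_repr g).
have [X PX Xg] : exists2 X, X \in P & g \in X.
  by move: Dg; rewrite -covP => /bigcupP.
rewrite (bigD1 X) //= Xg mul1r big1 ?addr0.
  by apply: aP PX _ _ _ _ => //; apply: mem_repr Xg.
move=> Y /andP[PY neYX]; case Yg: (g \in Y); last by rewrite mul0r.
case/eqP: neYX; by rewrite -(def_pblock tiP PX Xg) (def_pblock tiP PY Yg).
Qed.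

Lemma zmulE a b g : (a * b)%R g = (\sum_h a h * b (h^-1 * g)%g)%R.
Proof. by rewrite /GRing.mul /= ffunE. Qed.

(** Only closure under multiplication is a condition: for a partition with the
   class of the identity, the span always contains 1 and differences. *)
Lemma is_SringE G P :
  is_Sring G P <->
  [/\ partition P G, [set 1] \in P, {in P, forall X : {set gT}, X^-1 \in P}
    & forall a b, zspan P a -> zspan P b -> zspan P (a * b)%R].
Proof.
split=> [[partP P1 PV [_ _ PM]] | [partP P1 PV PM]]; split=> //; split=> //.
  have sP: [set 1] \subset (G : {set gT}) by rewrite sub1set group1.
  apply/(zspanE _ partP); split=> [g Gg | X PX x y Xx Xy].
    rewrite /GRing.one /= ffunE; case: eqP => // g1; by rewrite g1 group1 in Gg.
  have [_ tiP _] := and3P partP.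
  rewrite /GRing.one /= !ffunE.
  have Xe z : z \in X -> (z == 1) = (X == [set 1]).
    move=> Xz; apply/eqP/eqP=> [z1 | X1]; last by move: Xz; rewrite X1 => /set1P.
    have z1' : z \in [set 1] by rewrite z1 set11.
    by rewrite -(def_pblock tiP PX Xz) (def_pblock tiP P1 z1').
  by rewrite !Xe.
move=> a b /(zspanE _ partP)[a0 aP] /(zspanE _ partP)[b0 bP].
apply/(zspanE _ partP); split=> [g Gg | X PX x y Xx Xy].
  by rewrite !ffunE a0 // b0 // subr0.
by rewrite !ffunE (aP X PX x y) // (bP X PX x y).
Qed.

End Span.

(** * Induced S-rings *)

Section Substructures.
Variable gT : finGroupType.
Implicit Types (G U L : {group gT}) (P : {set {set gT}}).

Lemma partition_block P (D : {set gT}) x : partition P D -> x \in D ->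
  exists2 X, X \in P & x \in X.
Proof. by move/cover_partition=> <- /bigcupP. Qed.

Lemma partition_sub P (D X : {set gT}) : partition P D -> X \in P -> X \subset D.
Proof. by move=> /cover_partition <- PX; apply: bigcup_sup PX. Qed.

Lemma partition_eq P (D X Y : {set gT}) x : partition P D ->
  X \in P -> Y \in P -> x \in X -> x \in Y -> X = Y.
Proof.
move=> /and3P[_ tiP _] PX PY Xx Yx.
by rewrite -(def_pblock tiP PX Xx) (def_pblock tiP PY Yx).
Qed.

(** A-subgroups are the subgroups that are unions of basic sets. *)
Lemma AsubgroupE G P U : partition P G ->
  is_Asubgroup G P U <->
  U \subset G /\
  {in P, forall X : {set gT}, forall x, x \in X -> x \in U -> X \subset U}.
Proof.
move=> partP; split=> [[sUG /(zspanE _ partP)[_ cU]] | [sUG cU]].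
  split=> // X PX x Xx Ux; apply/subsetP=> y Xy.
  by have:= cU X PX x y Xx Xy; rewrite !ffunE Ux; case: (y \in U).
split=> //; apply/(zspanE _ partP); split=> [g /negP Gg | X PX x y Xx Xy].
  rewrite ffunE; case Ug: (g \in U) => //; by case: Gg; apply: subsetP sUG _ Ug.
have mU z : z \in X -> (z \in U) = (X \subset U).
  by move=> Xz; apply/idP/idP => [|/subsetP->//]; apply: cU Xz.
by rewrite !ffunE !mU.
Qed.

Lemma partition_Sring_sub G P U : partition P G -> is_Asubgroup G P U ->
  partition (Sring_sub P U) U.
Proof.
move=> partP /(AsubgroupE _ partP)[sUG cU].
have [_ tiP notP0] := and3P partP.
apply/and3P; split.
- apply/eqP/setP=> x; apply/bigcupP/idP=> [[X] | Ux].
    by rewrite inE => /andP[_ /subsetP sXU] /sXU.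
  have [X PX Xx] := partition_block partP (subsetP sUG _ Ux).
  by exists X => //; rewrite inE PX (cU _ PX x).
- by apply: trivIsetS tiP; apply/subsetP=> X; rewrite inE => /andP[].
by rewrite inE (negPf notP0).
Qed.

Lemma Sring_sub_Sring G P U : is_Sring G P -> is_Asubgroup G P U ->
  is_Sring U (Sring_sub P U).
Proof.
move=> /is_SringE[partP P1 PV PM] AU.
have partU := partition_Sring_sub partP AU.
have [sUG cU] := (AsubgroupE _ partP).1 AU.
have spanU (a : zgroup gT) : zspan (Sring_sub P U) a -> zspan P a.
  case/(zspanE _ partU)=> a0 aU; apply/(zspanE _ partP).
  split=> [g Gg | X PX x y Xx Xy].
    by apply: a0; apply: contra Gg; apply: (subsetP sUG).
  have [sXU | sXU] := boolP (X \subset U).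
    by apply: (aU X) => //; rewrite inE PX.
  by rewrite !a0 //; apply: contra sXU; apply: cU.
apply/is_SringE; split=> // [|X | a b Ua Ub].
- by rewrite inE P1 sub1set group1.
- by rewrite !inE => /andP[/PV-> sXU]; rewrite -(invGid U) invSg.
have /(zspanE _ partP)[_ abP] := PM _ _ (spanU _ Ua) (spanU _ Ub).
apply/(zspanE _ partU); split=> [g Ug | X]; last first.
  by rewrite inE => /andP[PX _]; apply: abP.
have [[a0 _] [b0 _]] := ((zspanE _ partU).1 Ua, (zspanE _ partU).1 Ub).
rewrite zmulE big1 // => h _; have [Uh | /a0->] := boolP (h \in U).
  by rewrite b0 ?mulr0 // groupMl ?groupV.
by rewrite mul0r.
Qed.

(** A basic set meeting [X * L], for an A-subgroup [L], lies in [X * L], because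
   [X * L] is the support of a product in the S-ring.  Hence the images of basic
   sets in the quotient by [L] are equal or disjoint. *)
Lemma basic_sub_mulg G P L (X Y : {set gT}) y :
  is_Sring G P -> is_Asubgroup G P L -> X \in P -> Y \in P ->
  y \in Y -> y \in X * L -> Y \subset X * L.
Proof.
move=> /is_SringE[partP P1 PV PM] AL PX PY Yy XLy.
have spX : zspan P (zsum X).
  apply/(zspanE _ partP); split=> [g Gg | Z PZ u v Zu Zv]; rewrite !ffunE.
    by case Xg: (g \in X) => //; rewrite (subsetP (partition_sub partP PX)) in Gg.
  have mX w : w \in Z -> (w \in X) = (Z == X).
    by move=> Zw; apply/idP/eqP => [Xw | <- //]; exact: (partition_eq partP PZ PX Zw Xw).
  by rewrite !mX.
have /(zspanE _ partP)[_ XLP] := PM _ _ spX AL.2.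
have memXL z : (z \in X * L) = ((zsum X * zsum L)%R z != 0%R).
  rewrite zmulE; under eq_bigr => h _ do rewrite !ffunE -natrM mulnb.
  rewrite -natr_sum Num.Theory.pnatr_eq0 sum_nat_eq0; apply/idP/idP.
    case/mulsgP=> x l Xx Ll ->; apply/forallPn; exists x.
    by rewrite mulKg Xx Ll.
  case/forallPn=> h; rewrite negb_imply /= eqb0 negbK => /andP[Xh Lh].
  by apply/mulsgP; exists h (h^-1 * z); rewrite // mulKVg.
apply/subsetP=> z Yz; rewrite memXL -(XLP Y PY y z) //.
by rewrite -memXL.
Qed.

End Substructures.

Section Quotient.
Variables (gT : finGroupType) (G L : {group gT}).
Implicit Types (P : {set {set gT}}).
Hypothesis nLG : G \subset 'N(L).

Lemma mem_quo (X : {set gT}) x : X \subset G -> x \in G ->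
  (coset L x \in X / L) = (x \in X * L).
Proof.
move=> sXG Gx; have nLX := subset_trans sXG nLG.
have nLx := subsetP nLG _ Gx.
apply/morphimP/mulsgP=> [[y nLy Xy] | [y l Xy Ll ->]].
  case/(rcoset_kercosetP nLx nLy)/rcosetP=> l Ll ->.
  exists y (l ^ y) => //; last by rewrite conjgC.
  by rewrite memJ_norm.
have nLy := subsetP nLX _ Xy; exists y => //.
by rewrite coset_kerr.
Qed.

Lemma quoP (X : {set gT}) (c : coset_of L) : X \subset G ->
  reflect (exists2 x, x \in X & c = coset L x) (c \in X / L).
Proof.
move=> sXG; apply: (iffP morphimP) => [[x _ Xx ->] | [x Xx ->]]; first by exists x.
by exists x => //; apply: subsetP nLG _ (subsetP sXG _ Xx).
Qed.

Lemma coset_eq_quo x y : x \in G -> y \in G ->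
  (coset L x == coset L y) = (x * y^-1 \in L).
Proof.
move=> Gx Gy; rewrite -mem_rcoset.
by apply/eqP/idP => /(rcoset_kercosetP (subsetP nLG _ Gx) (subsetP nLG _ Gy)).
Qed.

Lemma cosetM_quo x y : x \in G -> y \in G ->
  coset L (x * y) = coset L x * coset L y.
Proof. by move=> Gx Gy; rewrite morphM ?(subsetP nLG). Qed.

Lemma cosetV_quo x : x \in G -> coset L x^-1 = (coset L x)^-1.
Proof. by move=> Gx; rewrite morphV ?(subsetP nLG). Qed.

Lemma mem_quo_group (c : coset_of L) :
  c \in G / L -> exists2 x, x \in G & c = coset L x.
Proof. by move/(quoP _ (subxx G)). Qed.

Lemma sub_quo (X Y : {set gT}) : X \subset G -> Y \subset G ->
  (X / L \subset Y / L) = (X \subset Y * L).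
Proof.
move=> sXG sYG; apply/subsetP/subsetP=> sXY c.
  move=> Xc; rewrite -mem_quo ?(subsetP sXG) //; apply: sXY.
  by apply/quoP=> //; exists c.
case/quoP=> // x Xx ->; rewrite mem_quo ?(subsetP sXG) //; exact: sXY.
Qed.

Lemma partition_Sring_sec P : is_Sring G P -> is_Asubgroup G P L ->
  partition (Sring_sec P G L) (G / L).
Proof.
move=> SP AL; have [partP _ _ _] := SP.
have sP X : X \in P -> X \subset G by apply: partition_sub.
have [_ _ notP0] := and3P partP.
apply/and3P; split.
- apply/eqP/setP=> c; apply/bigcupP/idP=> [[_ /imsetP[X + ->]] | ].
    by rewrite inE => /andP[_ sXG]; apply: subsetP; apply: quotientS.
  case/mem_quo_group=> x Gx ->; have [X PX Xx] := partition_block partP Gx.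
  exists (X / L); first by apply: imset_f; rewrite inE PX sP.
  by apply/quoP; [apply: sP | exists x].
- apply/trivIsetP=> _ _ /imsetP[X + ->] /imsetP[Y + ->].
  rewrite !inE => /andP[PX sXG] /andP[PY sYG].
  apply: contraNT => /pred0Pn[c /= /andP[]].
  case/(quoP _ sXG)=> x Xx ->.
  have Gx := subsetP sXG _ Xx; rewrite mem_quo // => YLx.
  rewrite eqEsubset !sub_quo // (basic_sub_mulg SP AL PY PX Xx) //=.
  case/mulsgP: YLx => y l Yy Ll def_x.
  apply: (basic_sub_mulg SP AL PX PY Yy); apply/mulsgP.
  by exists x l^-1; rewrite ?groupV // def_x mulgK.
apply/imsetP=> [[X + XL0]]; rewrite inE => /andP[PX sXG].
have [X0 | [x Xx]] := set_0Vmem X; first by rewrite -X0 PX in notP0.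
have: coset L x \in X / L by apply/quoP=> //; exists x.
by rewrite -XL0 inE.
Qed.

Lemma card_coset_fiber (c : coset_of L) : L \subset G -> c \in G / L ->
  #|[set h in G | coset L h == c]| = #|L|.
Proof.
move=> sLG /mem_quo_group[x Gx ->]; rewrite -(card_rcoset L x).
apply: eq_card => h; rewrite inE.
apply/andP/idP => [[Gh] | Lxh]; first by rewrite coset_eq_quo // mem_rcoset.
have Gh : h \in G.
  by case/rcosetP: Lxh => l Ll ->; rewrite groupM // (subsetP sLG).
by rewrite coset_eq_quo // -mem_rcoset.
Qed.

(** The pull-back to [G] of an element of the group ring of [G / L], set to 0
   outside [G]. *)
Definition zlift (a : zgroup (coset_of L)) : zgroup gT :=
  [ffun g => if g \in G then a (coset L g) else 0%R].

(** The pull-back is multiplicative up to the factor [#|L|]; as that factor is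
   not a zero divisor, closure under products passes to the quotient. *)
Lemma zliftM (a b : zgroup (coset_of L)) g : L \subset G -> g \in G ->
  (forall c, c \notin G / L -> a c = 0%R) ->
  (zlift a * zlift b)%R g = ((a * b)%R (coset L g) *+ #|L|)%R.
Proof.
move=> sLG Gg a0; rewrite !zmulE (bigID (mem G)) /= [X in (_ + X)%R]big1 => [|h].
  rewrite addr0 (partition_big (coset L) (mem (G / L))) => [|h Gh]; last first.
    exact: mem_quotient.
  rewrite [in RHS](bigID (mem (G / L))) /= [X in (_ + X)%R]big1 => [|c /a0->].
    rewrite addr0 -sumrMnl; apply: eq_bigr => c GLc.
    rewrite (eq_bigr (fun=> (a c * b (c^-1 * coset L g)%g)%R)).
      rewrite -(card_coset_fiber sLG GLc) -sumr_const.
      by apply: eq_bigl => h; rewrite inE.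
    move=> h /andP[Gh /eqP<-]; rewrite !ffunE Gh groupM ?groupV //.
    by rewrite cosetM_quo ?groupV // cosetV_quo.
  by rewrite mul0r.
by move=> Gh; rewrite ffunE (negPf Gh) mul0r.
Qed.

Lemma Sring_sec_Sring P : is_Sring G P -> is_Asubgroup G P L ->
  is_Sring (G / L) (Sring_sec P G L).
Proof.
move=> SP AL; have [sLG _] := AL.
have partQ := partition_Sring_sec SP AL.
have [partP P1 PV PM] := (is_SringE _ _).1 SP.
have sP X : X \in P -> X \subset G by apply: partition_sub.
have liftP a : zspan (Sring_sec P G L) a -> zspan P (zlift a).
  case/(zspanE _ partQ)=> a0 aQ; apply/(zspanE _ partP).
  split=> [g /negPf Gg | X PX x y Xx Xy]; first by rewrite ffunE Gg.
  have [Gx Gy] : x \in G /\ y \in G by rewrite !(subsetP (sP X PX)).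
  rewrite !ffunE Gx Gy; apply: (aQ (X / L)).
  - by apply: imset_f; rewrite inE PX sP.
  - by apply/quoP; [apply: sP | exists x].
  by apply/quoP; [apply: sP | exists y].
apply/is_SringE; split=> // [| _ /imsetP[X + ->] | a b Qa Qb].
- apply/imsetP; exists [set 1]; first by rewrite inE P1 sub1set group1.
  have s1G : [set 1] \subset G by rewrite sub1set group1.
  apply/setP=> c; rewrite inE; apply/eqP/(quoP _ s1G) => [-> | [x /set1P-> ->]].
    by exists 1; rewrite ?set11 // morph1.
  by rewrite morph1.
- rewrite inE => /andP[PX sXG]; apply/imsetP; exists X^-1.
    by rewrite inE PV // -(invGid G) invSg.
  by rewrite !quotientE morphimV // (subset_trans sXG).
have [[a0 _] [b0 _]] := ((zspanE _ partQ).1 Qa, (zspanE _ partQ).1 Qb).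
have /(zspanE _ partP)[_ abP] := PM _ _ (liftP _ Qa) (liftP _ Qb).
apply/(zspanE _ partQ); split=> [c GLc | _ /imsetP[X + ->] c d].
  rewrite zmulE big1 // => h _; have [GLh | /a0->] := boolP (h \in G / L).
    by rewrite b0 ?mulr0 // groupMl ?groupV.
  by rewrite mul0r.
rewrite inE => /andP[PX sXG] /(quoP _ sXG)[x Xx ->] /(quoP _ sXG)[y Xy ->].
have [Gx Gy] : x \in G /\ y \in G by rewrite !(subsetP sXG).
have nzL : (#|L|%:R : int)%R != 0%R.
  by rewrite Num.Theory.pnatr_eq0 -lt0n cardG_gt0.
apply: (mulIf nzL); rewrite !mulr_natr -!zliftM //.
exact: (abP X PX x y Xx Xy).
Qed.

End Quotient.

Section Image.
Variables (gT : finGroupType) (G : {group gT}).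
Implicit Types (P : {set {set gT}}) (f s : {perm gT}).

Lemma imset_permM (T : finType) (s t : {perm T}) (X : {set T}) :
  (s * t)%g @: X = t @: (s @: X).
Proof. by rewrite -imset_comp; apply: eq_imset => x; rewrite /= permM. Qed.

Lemma imset_permK (T : finType) (s : {perm T}) (X : {set T}) :
  s^-1%g @: (s @: X) = X.
Proof.
by rewrite -imset_permM mulgV -[RHS]imset_id; apply: eq_imset => x; rewrite perm1.
Qed.

Lemma Aut_onP s : s \in Aut G ->
  perm_on G s /\ {in G &, {morph s : x y / x * y}}.
Proof. by rewrite inE => /andP[-> /morphicP]. Qed.

Lemma partition_perm P (D : {set gT}) s : partition P D -> s @: D = D ->
  partition [set s @: (X : {set gT}) | X in P] D.
Proof.
move=> /and3P[/eqP covP tiP notP0] sD; apply/and3P; split.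
- rewrite -[X in _ == X]sD -[in X in _ == X]covP; apply/eqP/setP=> y.
  apply/bigcupP/imsetP=> [[_ /imsetP[X PX ->] /imsetP[x Xx ->]] | [x + ->]].
    by exists x => //; apply/bigcupP; exists X.
  by case/bigcupP=> X PX Xx; exists (s @: X); rewrite imset_f.
- apply/trivIsetP=> _ _ /imsetP[X PX ->] /imsetP[Y PY ->] neXY.
  rewrite -setI_eq0 -imsetI; last by move=> x y _ _; apply: perm_inj.
  rewrite imset_eq0 setI_eq0; apply: (trivIsetP tiP) => //.
  by apply: contraNneq neXY => ->.
apply/imsetP=> [[X PX /esym/eqP]]; rewrite imset_eq0 => /eqP X0.
by rewrite X0 in PX; rewrite PX in notP0.
Qed.

Lemma imset_perm_on (D : {set gT}) s : perm_on D s -> s @: D = D.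
Proof.
move=> onD; apply/eqP; rewrite eqEcard card_imset ?leqnn ?andbT; last exact: perm_inj.
by apply/subsetP=> _ /imsetP[x Dx ->]; rewrite perm_closed.
Qed.

Lemma Sring_Aut P s : s \in Aut G -> is_Sring G P ->
  is_Sring G [set s @: (X : {set gT}) | X in P].
Proof.
move=> As /is_SringE[partP P1 PV PM]; have [onG sM] := Aut_onP As.
have sG x : (s x \in G) = (x \in G) by apply: perm_closed.
have s1 : s 1 = 1 by apply: (mulIg (s 1)); rewrite -sM ?group1 // !mul1g.
have sV x : x \in G -> s x^-1 = (s x)^-1.
  move=> Gx; apply: (mulIg (s x)).
  by rewrite -sM ?groupV // !mulVg.
have partQ := partition_perm partP (imset_perm_on onG).
pose pb (a : zgroup gT) : zgroup gT := [ffun g => a (s g)].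
have pbP a : zspan [set s @: (X : {set gT}) | X in P] a -> zspan P (pb a).
  case/(zspanE _ partQ)=> a0 aQ; apply/(zspanE _ partP).
  split=> [g Gg | X PX x y Xx Xy]; rewrite !ffunE; first by rewrite a0 ?sG.
  by apply: (aQ (s @: X)); rewrite ?imset_f.
apply/is_SringE; split=> // [| _ /imsetP[X PX ->] | a b Qa Qb].
- by apply/imsetP; exists [set 1] => //; rewrite imset_set1 s1.
- apply/imsetP; exists X^-1; first exact: PV.
  have sXG := subsetP (partition_sub partP PX).
  apply/setP=> y; rewrite inE; apply/imsetP/imsetP=> [[x Xx yx] | [x]].
    by exists x^-1; rewrite ?inE ?invgK // sV ?sXG // -yx invgK.
  by rewrite inE => Xx ->; exists x^-1; rewrite // -sV // -groupV sXG.
have [[a0 _] [b0 _]] := ((zspanE _ partQ).1 Qa, (zspanE _ partQ).1 Qb).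
have /(zspanE _ partP)[_ abP] := PM _ _ (pbP _ Qa) (pbP _ Qb).
apply/(zspanE _ partQ); split=> [c Gc | _ /imsetP[X PX ->]].
  rewrite zmulE big1 // => h _; have [Gh | /a0->] := boolP (h \in G).
    by rewrite b0 ?mulr0 // groupMl ?groupV.
  by rewrite mul0r.
have pbM g : g \in G -> (pb a * pb b)%R g = (a * b)%R (s g).
  move=> Gg; rewrite !zmulE [RHS](reindex_inj (@perm_inj _ s)) /=.
  apply: eq_bigr => h _; rewrite !ffunE; have [Gh | Gh] := boolP (h \in G).
    by rewrite sM ?groupV ?sV.
  by rewrite a0 ?sG // !mul0r.
have sXG := subsetP (partition_sub partP PX).
move=> _ _ /imsetP[x Xx ->] /imsetP[y Xy ->].
by rewrite -!pbM ?sXG // (abP X PX x y).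
Qed.

End Image.

(** * Normalized isomorphisms and the CI property *)

Section Isomorphisms.
Variable gT : finGroupType.
Implicit Types (G U L : {group gT}) (P : {set {set gT}}) (X Y : {set gT}).
Implicit Types (f s phi : {perm gT}).

Lemma card_Rrel G X : #|Rrel G X| = (#|X| * #|G|)%N.
Proof.
rewrite /Rrel curry_imset2X card_in_imset ?cardsX //.
move=> [x g] [y h] _ _ [-> /mulIg->] //.
Qed.

Lemma rel_img_memP G X Y f : perm_on G f -> rel_img f (Rrel G X) = Rrel G Y ->
  {in X & G, forall x g, f (x * g) * (f g)^-1 \in Y}.
Proof.
move=> onG fXY x g Xx Gg.
have: (f g, f (x * g)) \in Rrel G Y.
  by rewrite -fXY; apply/imsetP; exists (g, x * g) => //; apply: imset2_f.
by case/imset2P=> y h Yy _ [-> ->]; rewrite mulgK.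
Qed.

Lemma rel_img_eq G X Y f : perm_on G f -> #|X| = #|Y| ->
    {in X & G, forall x g, f (x * g) * (f g)^-1 \in Y} ->
  rel_img f (Rrel G X) = Rrel G Y.
Proof.
move=> onG cXY fXY; apply/eqP; rewrite eqEcard; apply/andP; split.
  apply/subsetP=> _ /imsetP[_ /imset2P[x g Xx Gg ->] ->] /=.
  apply/imset2P; exists (f (x * g) * (f g)^-1) (f g).
  - exact: fXY.
  - by rewrite perm_closed.
  by rewrite mulgKV.
rewrite card_imset; first by rewrite !card_Rrel cXY.
by move=> [x y] [u v] [/perm_inj-> /perm_inj->].
Qed.

Lemma AutSrP G P f : reflect
  (perm_on G f /\
   {in P, forall X, {in X & G, forall x g, f (x * g) * (f g)^-1 \in X}})
  (f \in AutSr G P).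
Proof.
rewrite inE; apply: (iffP andP) => [[onG /'forall_implyP fP] | [onG fP]].
  split=> // X PX; apply: rel_img_memP => //; exact/eqP/fP.
split=> //; apply/'forall_implyP=> X PX; apply/eqP.
by apply: rel_img_eq => //; apply: fP.
Qed.

(** Isomorphisms [f] onto an S-ring over [G] that fix the identity; such an [f]
   sends the basic relation of [X] to that of [f @: X]. *)
Definition normal_iso G P f : Prop :=
  [/\ perm_on G f, f 1 = 1, is_Sring G [set f @: (X : {set gT}) | X in P]
    & {in P, forall X, {in X & G, forall x g, f (x * g) * (f g)^-1 \in f @: X}}].

Lemma normal_iso_Iso G P f : normal_iso G P f -> in_Iso G P f.
Proof.
case=> onG f1 Sf fP; split=> //; exists [set f @: (X : {set gT}) | X in P] => //.
rewrite -imset_comp; apply: eq_in_imset => X PX /=.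
by apply: rel_img_eq; rewrite ?card_imset //; [apply: perm_inj | apply: fP].
Qed.

Lemma Iso_normal_iso G P f : in_Iso G P f -> f 1 = 1 -> normal_iso G P f.
Proof.
case=> onG [P' SP' eqPP'] f1.
have imR X Y : rel_img f (Rrel G X) = Rrel G Y -> Y = f @: X.
  move=> fXY; apply/setP=> y; apply/idP/imsetP => [Yy | [x Xx ->]].
    have: (1, y) \in Rrel G Y by apply/imset2P; exists y 1; rewrite ?mulg1.
    rewrite -fXY => /imsetP[_ /imset2P[x g Xx Gg ->]] /= [].
    rewrite -f1 => /perm_inj <- ->; exists x; by rewrite ?mulg1.
  have := rel_img_memP onG fXY Xx (group1 G).
  by rewrite f1 invg1 !mulg1.
have ex_im X : X \in P -> exists2 Y, Y \in P' & rel_img f (Rrel G X) = Rrel G Y.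
  move=> PX; have: rel_img f (Rrel G X) \in [set Rrel G (X' : {set gT}) | X' in P'].
    by rewrite -eqPP'; apply: imset_f.
  by case/imsetP=> Y; exists Y.
suff defP' : [set f @: (X : {set gT}) | X in P] = P'.
  split=> //; first by rewrite defP'.
  move=> X PX; have [Y _ fXY] := ex_im X PX.
  by rewrite -(imR _ _ fXY); apply: rel_img_memP.
apply/setP=> Y; apply/imsetP/idP=> [[X PX ->] | P'Y].
  by have [Y' P'Y' fXY] := ex_im X PX; rewrite -(imR _ _ fXY).
have: Rrel G Y \in [set rel_img f (Rrel G (X : {set gT})) | X in P].
  by rewrite eqPP'; apply: imset_f.
by case/imsetP=> X PX /esym/imR->; exists X.
Qed.

Lemma Aut_fix1 G s : s \in Aut G -> s 1 = 1.
Proof.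
case/Aut_onP=> onG sM; apply: (mulIg (s 1)).
by rewrite -sM ?group1 // !mul1g.
Qed.

Lemma Aut_morphV G s x : s \in Aut G -> x \in G -> s x^-1 = (s x)^-1.
Proof.
move=> As Gx; have [onG sM] := Aut_onP As; apply: (mulIg (s x)).
by rewrite -sM ?groupV // !mulVg (Aut_fix1 As).
Qed.

Lemma normal_iso_Aut G P f s : normal_iso G P f -> s \in Aut G ->
  normal_iso G P (f * s).
Proof.
case=> onG f1 Sf fP As; have [onGs sM] := Aut_onP As.
split=> [|||X PX x g Xx Gg].
- exact: perm_onM.
- by rewrite permM f1 (Aut_fix1 As).
- rewrite (_ : imset _ _ = [set s @: (Y : {set gT}) | Y in
    [set f @: (X : {set gT}) | X in P]]); first exact: Sring_Aut.
  by rewrite -imset_comp; apply: eq_imset => X; rewrite imset_permM.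
have [partf _ _ _] := Sf.
have GfX := subsetP (partition_sub partf (imset_f _ PX)).
have Gf y : (f y \in G) = (y \in G) by apply: perm_closed.
rewrite imset_permM !permM; apply/imsetP; exists (f (x * g) * (f g)^-1).
  exact: fP.
have Gx : x \in G by rewrite -Gf GfX // imset_f.
by rewrite sM ?groupV ?Gf ?groupM // (Aut_morphV As) // Gf.
Qed.

(** A normalized isomorphism lies in [AutSr G P * Aut G] as soon as some
   automorphism of [G] has the same images of basic sets. *)
Lemma normal_iso_mem_AutM G P f phi : partition P G -> normal_iso G P f ->
    phi \in Aut G -> {in P, forall X : {set gT}, phi @: X = f @: X} ->
  f \in AutSr G P * Aut G.
Proof.
move=> partP [onG f1 _ fP] Aphi phiP; apply/mulsgP.
exists (f * phi^-1) phi => //; last by rewrite mulgKV.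
have [onGp _] := Aut_onP Aphi; have AV := groupVr Aphi.
have [onGV VM] := Aut_onP AV.
apply/AutSrP; split=> [|X PX x g Xx Gg]; first exact: perm_onM.
have Gf y : (f y \in G) = (y \in G) by apply: perm_closed.
have Gx := subsetP (partition_sub partP PX) _ Xx.
rewrite !permM -(Aut_morphV AV) ?Gf // -VM ?groupV ?Gf ?groupM //.
have := fP X PX x g Xx Gg; rewrite -phiP // => /imsetP[y Xy ->].
by rewrite permK.
Qed.

Lemma CI_normal_iso G P f : is_CI G P -> normal_iso G P f ->
  exists2 phi, phi \in Aut G & {in P, forall X : {set gT}, phi @: X = f @: X}.
Proof.
move=> CI nf; have [_ f1 _ _] := nf.
have /mulsgP[a phi /AutSrP[onGa aP] Aphi def_f] := (CI f).2 (normal_iso_Iso nf).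
exists phi => // X PX.
have a1 : a 1 = 1.
  by apply: (@perm_inj _ phi); rewrite -permM -def_f f1 (Aut_fix1 Aphi).
have aX : a @: X = X.
  apply/eqP; rewrite eqEcard card_imset ?leqnn ?andbT; last exact: perm_inj.
  apply/subsetP=> _ /imsetP[x Xx ->].
  by have := aP X PX x 1 Xx (group1 G); rewrite a1 invg1 !mulg1.
by rewrite def_f imset_permM aX.
Qed.

(** Right translations lie in [AutSr G P], so only normalized isomorphisms
   matter. *)
Lemma CI_intro G P : is_Sring G P ->
  (forall f, normal_iso G P f ->
    exists2 phi, phi \in Aut G & {in P, forall X : {set gT}, phi @: X = f @: X}) ->
  is_CI G P.
Proof.
move=> SP ex_phi f; have [partP _ _ _] := SP; split.
  case/mulsgP=> a phi /AutSrP[onGa aP] Aphi ->.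
  have [onGp phiM] := Aut_onP Aphi.
  split; first exact: perm_onM.
  exists [set phi @: (X : {set gT}) | X in P]; first exact: Sring_Aut.
  rewrite -imset_comp; apply: eq_in_imset => X PX /=.
  apply: rel_img_eq; rewrite ?card_imset //; try exact: perm_inj.
    exact: perm_onM.
  move=> x g Xx Gg; have Gx := subsetP (partition_sub partP PX) _ Xx.
  have Ga y : (a y \in G) = (y \in G) by apply: perm_closed.
  rewrite !permM -(Aut_morphV Aphi) ?Ga // -phiM ?groupV ?Ga ?groupM //.
  by rewrite imset_f // aP.
move=> If; have [onG _] := If.
pose d := f^-1 1.
have Gd : d \in G by rewrite -(perm_closed _ onG) permKV group1.
have injt : {in G &, injective (mulg^~ d)} by move=> x y _ _ /mulIg.
have tG : [set x * d | x in G] \subset G.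
  by apply/subsetP=> _ /imsetP[x Gx ->]; rewrite groupM.
pose t := perm_in injt tG.
have tE x : x \in G -> t x = x * d by apply: perm_inE.
have onGt : perm_on G t by apply: perm_in_on.
have tX X : X \subset G -> rel_img t (Rrel G X) = Rrel G X.
  move=> sXG; apply: rel_img_eq => // x g Xx Gg.
  have Gx := subsetP sXG _ Xx; rewrite !tE ?groupM //.
  by rewrite invMg mulgA mulgK mulgK.
have At : t \in AutSr G P.
  apply/AutSrP; split=> //. move=> X PX; apply: rel_img_memP => //.
  by rewrite tX // (partition_sub partP).
have AtV : t^-1 \in AutSr G P.
  rewrite inE perm_onV //; apply/'forall_implyP=> X PX; apply/eqP.
  rewrite -{1}(tX X) ?(partition_sub partP) // /rel_img -imset_comp.
  rewrite -[RHS]imset_id; apply: eq_imset => [[x y]] /=.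
  by rewrite !permK.
have Itf : in_Iso G P (t * f).
  split; first exact: perm_onM.
  have [_ [P' SP' eqPP']] := If; exists P' => //; rewrite -eqPP'.
  apply: eq_in_imset => X PX; rewrite -[in RHS](tX X) ?(partition_sub partP) //.
  by rewrite /rel_img -imset_comp; apply: eq_imset => [[x y]] /=; rewrite !permM.
have ntf : normal_iso G P (t * f).
  by apply: Iso_normal_iso => //; rewrite permM tE // mul1g permKV.
have [phi Aphi phiP] := ex_phi _ ntf.
have /mulsgP[a b Aa Ab def_tf] := normal_iso_mem_AutM partP ntf Aphi phiP.
apply/mulsgP; exists (t^-1 * a) b => //; last by rewrite -mulgA -def_tf mulKg.
move: AtV Aa; rewrite !inE => /andP[on1 /'forall_implyP t1] /andP[on2 /'forall_implyP t2].
apply/andP; split; first exact: perm_onM.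
apply/'forall_implyP=> X PX; rewrite -[in X in _ == X](eqP (t2 X PX)).
rewrite -{2}(eqP (t1 X PX)) /rel_img -imset_comp; apply/eqP.
by apply: eq_imset => [[x y]] /=; rewrite !permM.
Qed.

End Isomorphisms.

(** * Isomorphisms induced on A-subgroups and quotients *)

Section Induced.
Variable gT : finGroupType.
Implicit Types (G U L H : {group gT}) (P : {set {set gT}}) (X Y : {set gT}).
Implicit Types (f s phi : {perm gT}).

Lemma normal_iso_coset G P f H : is_Asubgroup G P H -> normal_iso G P f ->
  {in H & G, forall h g, f (h * g) * (f g)^-1 \in f @: H}.
Proof.
move=> AH [onG f1 Sf fP] h g Hh Gg; have [sHG _] := AH.
have partP : partition P G.
  (* [P] is the image under [f^-1] of the partition [f @: P] *)
  have fV : [set f^-1%g @: (Y : {set gT}) | Y in [set f @: (X : {set gT}) | X in P]] = P.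
    rewrite -imset_comp -[RHS]imset_id; apply: eq_imset => X /=.
    exact: imset_permK.
  by have [partf _ _ _] := Sf; rewrite -fV; apply: partition_perm => //;
     apply: imset_perm_on; apply: perm_onV.
have [_ cH] := (AsubgroupE _ partP).1 AH.
have [X PX Xh] := partition_block partP (subsetP sHG _ Hh).
by apply: subsetP (fP X PX h g Xh Gg); apply: imsetS; apply: cH PX _ Xh Hh.
Qed.

Lemma normal_iso_rcoset G P f H g : is_Asubgroup G P H -> normal_iso G P f ->
  g \in G -> f @: (H :* g) = (f @: H) :* f g.
Proof.
move=> AH nf Gg; apply/eqP; rewrite eqEcard card_rcoset.
rewrite !card_imset ?card_rcoset ?leqnn ?andbT; try exact: perm_inj.
apply/subsetP=> _ /imsetP[_ /rcosetP[h Hh ->] ->].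
by rewrite mem_rcoset (normal_iso_coset AH nf).
Qed.

(** The image of an A-subgroup is a subgroup for the image S-ring. *)
Lemma normal_iso_subgroup G P f H : partition P G -> is_Asubgroup G P H ->
    normal_iso G P f ->
  exists2 H' : {group gT}, H' = f @: H :> {set gT}
    & is_Asubgroup G [set f @: (X : {set gT}) | X in P] H'.
Proof.
move=> partP AH nf; have fH := normal_iso_coset AH nf.
have [onG f1 [partf _ _ _] fP] := nf; have [sHG cH] := (AsubgroupE _ partP).1 AH.
have gH : group_set (f @: H).
  apply/group_setP; split=> [|_ _ /imsetP[x Hx ->] /imsetP[y Hy ->]].
    by rewrite -f1 imset_f.
  have {1}-> : f @: H = (f @: H) :* f y.
    by rewrite -(normal_iso_rcoset AH nf) ?rcoset_id // (subsetP sHG).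
  by rewrite mem_rcoset mulgK imset_f.
exists (Group gH) => //; apply/(AsubgroupE _ partf); split=> /=.
  by rewrite -(imset_perm_on onG) imsetS.
move=> _ /imsetP[X PX ->] _ /imsetP[x Xx ->] /imsetP[y Hy /perm_inj eqxy].
by apply: imsetS; apply: cH PX _ Xx _; rewrite eqxy.
Qed.

Lemma restr_perm_imset f (D X : {set gT}) : f @: D = D -> X \subset D ->
  restr_perm D f @: X = f @: X.
Proof.
move=> fD sXD; apply: eq_in_imset => x Xx.
rewrite restr_permE ?(subsetP sXD) //; apply/astabsP=> y /=.
by rewrite apermE -{1}fD (mem_imset _ _ (@perm_inj _ f)).
Qed.

Lemma normal_iso_restr G P f U : partition P G -> is_Asubgroup G P U ->
    normal_iso G P f -> f @: U = U ->
  normal_iso U (Sring_sub P U) (restr_perm U f).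
Proof.
move=> partP AU nf fU; have [onG f1 Sf fP] := nf.
have [U' defU' AU'] := normal_iso_subgroup partP AU nf.
have [sUG _] := AU.
have fUE x : x \in U -> restr_perm U f x = f x.
  move=> Ux; rewrite restr_permE //; apply/astabsP=> y /=.
  by rewrite apermE -{1}fU (mem_imset _ _ (@perm_inj _ f)).
have {}defU' : U' = U by apply/val_inj; rewrite /= defU'.
split; rewrite ?restr_perm_on ?fUE //.
  rewrite (_ : imset _ _ = Sring_sub [set f @: (X : {set gT}) | X in P] U).
    by apply: (Sring_sub_Sring (G := G)); rewrite -?defU'.
  apply/setP=> Y; rewrite inE; apply/imsetP/andP => [[X] | [/imsetP[X PX ->] sfXU]].
    rewrite inE => /andP[PX sXU] ->; rewrite restr_perm_imset //.
    by rewrite imset_f //= -fU imsetS.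
  have sXU: X \subset U.
    apply/subsetP=> x Xx; rewrite -(mem_imset _ _ (@perm_inj _ f)) fU.
    by rewrite (subsetP sfXU) // imset_f.
  by exists X; rewrite ?restr_perm_imset // inE PX.
move=> X; rewrite inE => /andP[PX sXU] x u Xx Uu.
have Ux := subsetP sXU _ Xx; rewrite restr_perm_imset // !fUE ?groupM //.
by apply: fP => //; apply: subsetP Uu.
Qed.

(** A map of [H] compatible with the cosets of [L] induces a permutation of
   [H / L]. *)
Lemma quotient_perm H L (f : gT -> gT) : H \subset 'N(L) ->
    {in H, forall x, f x \in H} ->
    {in H &, forall x y, (coset L (f x) == coset L (f y)) = (coset L x == coset L y)} ->
  exists2 h : {perm coset_of L}, perm_on (H / L) h
    & {in H, forall x, h (coset L x) = coset L (f x)}.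
Proof.
move=> nLH fH fL.
pose r (c : coset_of L) := odflt 1 [pick x in H | coset L x == c].
have rP c : c \in H / L -> r c \in H /\ coset L (r c) = c.
  case/(mem_quo_group nLH)=> x Hx ->; rewrite /r.
  by case: pickP => [y /andP[Hy /eqP] | /(_ x)]; rewrite // Hx eqxx.
have inj_h : {in H / L &, injective (fun c => coset L (f (r c)))}.
  move=> c d /rP[Hc cK] /rP[Hd dK] /eqP.
  by rewrite fL // cK dK => /eqP.
have h_on : [set coset L (f (r c)) | c in H / L] \subset H / L.
  by apply/subsetP=> _ /imsetP[c /rP[Hc _] ->]; rewrite mem_quotient ?fH.
exists (perm_in inj_h h_on); first exact: perm_in_on.
move=> x Hx; have HLx := mem_quotient L Hx; rewrite perm_inE //.
have [Hr rK] := rP _ HLx.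
by apply/eqP; rewrite fL // rK.
Qed.

Lemma quotient_imset H L (f : gT -> gT) (h : coset_of L -> coset_of L) X :
    H \subset 'N(L) -> {in H, forall x, h (coset L x) = coset L (f x)} ->
    X \subset H -> f @: X \subset H ->
  h @: (X / L) = f @: X / L.
Proof.
move=> nLH hE sXH sfXH; apply/setP=> c.
apply/imsetP/(quoP nLH _ sfXH) => [[_ /(quoP nLH _ sXH)[x Xx ->] ->] |].
  by exists (f x); rewrite ?imset_f // hE // (subsetP sXH).
case=> _ /imsetP[x Xx ->] ->; exists (coset L x); last by rewrite hE // (subsetP sXH).
by apply/(quoP nLH _ sXH); exists x.
Qed.

Lemma normal_iso_quotient G P f L : is_Sring G P -> is_Asubgroup G P L ->
    G \subset 'N(L) -> normal_iso G P f -> f @: L = L ->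
  exists2 fq : {perm coset_of L}, normal_iso (G / L) (Sring_sec P G L) fq
    & {in G, forall x, fq (coset L x) = coset L (f x)}.
Proof.
move=> SP AL nLG nf fL; have [onG f1 Sf fP] := nf.
have [partP _ _ _] := SP; have [sLG _] := AL.
have Gf y : (f y \in G) = (y \in G) by apply: perm_closed.
have imf X : X \subset G -> f @: X \subset G.
  by move=> sXG; rewrite -(imset_perm_on onG) imsetS.
have [L' defL' AL'] := normal_iso_subgroup partP AL nf.
have {}defL' : L' = L by apply/val_inj; rewrite /= defL'.
have compat : {in G &, forall x y,
    (coset L (f x) == coset L (f y)) = (coset L x == coset L y)}.
  move=> x y Gx Gy /=; rewrite !(coset_eq_quo nLG) ?Gf //.
  rewrite -!mem_rcoset -{1}fL -(normal_iso_rcoset AL nf) //.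
  by rewrite (mem_imset _ _ (@perm_inj _ f)).
have [fq onq fqE] := quotient_perm nLG (fun x Gx => etrans (Gf x) Gx) compat.
exists fq => //.
have imq X : X \subset G -> fq @: (X / L) = (f @: X) / L.
  by move=> sXG; apply: quotient_imset nLG fqE sXG (imf _ sXG).
split=> //.
- by rewrite -(morph1 (coset L)) fqE ?f1.
- rewrite (_ : imset _ _ = Sring_sec [set f @: (X : {set gT}) | X in P] G L).
    by rewrite defL' in AL'; apply: (Sring_sec_Sring nLG).
  apply/setP=> Y; apply/imsetP/imsetP => [[_ /imsetP[X + ->] ->] | [Z + ->]].
    rewrite inE => /andP[PX sXG]; exists (f @: X); last exact: imq.
    by rewrite inE imset_f ?imf.
  rewrite inE => /andP[/imsetP[X PX ->] _] {Z}.
  have sXG := partition_sub partP PX; exists (X / L); last by rewrite imq.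
  by apply: imset_f; rewrite inE PX.
move=> _ /imsetP[X + ->]; rewrite inE => /andP[PX sXG].
move=> _ _ /(quoP nLG _ sXG)[x Xx ->] /(mem_quo_group nLG)[g Gg ->].
have Gx := subsetP sXG _ Xx.
rewrite -(cosetM_quo nLG) // !fqE ?groupM // -(cosetV_quo nLG) ?Gf //.
rewrite -(cosetM_quo nLG) ?groupV ?Gf ?groupM // imq //.
by apply/(quoP nLG _ (imf _ sXG)); exists (f (x * g) * (f g)^-1); rewrite ?fP.
Qed.

End Induced.

(** * Extending and lifting homomorphisms on primary components *)

Section AbelemExtension.
Variables (gT : finGroupType) (p : nat).
Implicit Types (H A B U : {group gT}).

Lemma abelem_retraction H U : p.-abelem H -> U \subset H ->
  exists r : gT -> gT, [/\ {in H &, {morph r : x y / x * y}},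
    {in H, forall x, r x \in U} & {in U, r =1 id}].
Proof.
move=> abH sUH; have [W defH] := abelem_split_dprod abH sUH.
have [_ UW cUW tiUW] := dprodP defH.
have complW : W \in [complements to U in H] by apply/complP.
exists (divgr U W); split=> [x y Hx Hy | x Hx | x Ux].
- exact: (divgrM complW).
- by apply: mem_divgr; rewrite UW.
exact: divgr_id.
Qed.

(** An injective homomorphism between subgroups of the same order extends to an
   injective homomorphism between elementary abelian overgroups of the same order. *)
Lemma abelem_iso_ext H H' A A' (f : gT -> gT) :
    p.-abelem H -> p.-abelem H' -> #|H| = #|H'| ->
    A \subset H -> A' \subset H' -> #|A| = #|A'| ->
    {in A &, {morph f : x y / x * y}} -> {in A, forall x, f x \in A'} ->
    {in A, forall x, f x = 1 -> x = 1} ->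
  exists g : gT -> gT, [/\ {in H &, {morph g : x y / x * y}},
    {in H, forall x, g x \in H'}, {in H, forall x, g x = 1 -> x = 1}
    & {in A, g =1 f}].
Proof.
move=> abH abH' cH sAH sA'H' cA fM fA f1.
have [B defH] := abelem_split_dprod abH sAH.
have [B' defH'] := abelem_split_dprod abH' sA'H'.
have [_ AB cAB tiAB] := dprodP defH.
have [_ AB' cAB' tiAB'] := dprodP defH'.
have sBH : B \subset H by rewrite -AB mulG_subr.
have sBH' : B' \subset H' by rewrite -AB' mulG_subr.
have cB : #|B| = #|B'|.
  apply/eqP; rewrite -(eqn_pmul2l (cardG_gt0 A)) {2}cA.
  by rewrite (dprod_card defH) (dprod_card defH') cH.
have: B \isog B'.
  rewrite (isog_abelem_card _ (abelemS sBH abH)) (abelemS sBH' abH').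
  by rewrite cB eqxx.
case/isogP=> h injh hB.
have complB : B \in [complements to A in H] by apply/complP.
have HAB x : x \in H -> x \in A * B by rewrite AB.
have abelH := abelem_abelian abH; have abelH' := abelem_abelian abH'.
have nAH : A <| H by rewrite -sub_abelian_normal.
have hB' x : x \in B -> h x \in B' by move=> Bx; rewrite -hB mem_morphim.
pose g x := f (divgr A B x) * h (remgr A B x).
exists g; split=> [x y Hx Hy | x Hx | x Hx | x Ax]; rewrite /g.
- rewrite (divgrM complB) // (remgrM complB) //.
  have [Ax Ay] : divgr A B x \in A /\ divgr A B y \in A.
    by rewrite !mem_divgr ?HAB.
  have [Bx By] : remgr A B x \in B /\ remgr A B y \in B.
    by rewrite !mem_remgr ?HAB.
  rewrite fM // morphM // -!mulgA; congr (_ * _); rewrite !mulgA; congr (_ * _).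
  apply: (centsP abelH'); first exact: subsetP sA'H' _ (fA _ Ay).
  exact: subsetP sBH' _ (hB' _ Bx).
- rewrite groupM //.
    by apply: subsetP sA'H' _ (fA _ _); rewrite mem_divgr ?HAB.
  by apply: subsetP sBH' _ (hB' _ _); rewrite mem_remgr ?HAB.
- move=> fh1; have Ax := mem_divgr (HAB _ Hx); have Bx := mem_remgr (HAB _ Hx).
  have fx : f (divgr A B x) \in A' :&: B'.
    rewrite inE fA //= -(mulgK (h (remgr A B x)) (f _)) fh1 mul1g groupV.
    exact: hB'.
  move: fx; rewrite tiAB' => /set1P fx; move: fh1; rewrite fx mul1g => hx.
  rewrite (divgr_eq A B x) (f1 _ Ax fx) mul1g.
  by apply/eqP; rewrite -(morph_injm_eq1 injh) // hx.
by rewrite divgr_id // remgr1 // morph1 mulg1.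
Qed.

End AbelemExtension.

Section Lifting.
Variables (gT rT : finGroupType).
Implicit Types (H U : {group gT}).

(** Given [pi] and [psi] on [H] with the image of [psi] inside that of [pi], a
   partial lift [f] of [psi] through [pi] extends to [H]. *)
Lemma abelem_lift p H U (f : gT -> gT) (pi psi : gT -> rT) :
    p.-abelem H -> U \subset H ->
    {in U &, {morph f : x y / x * y}} -> {in U, forall x, f x \in H} ->
    {in H &, {morph pi : x y / x * y}} -> {in H &, {morph psi : x y / x * y}} ->
    {in H, forall x, exists2 y, y \in H & pi y = psi x} ->
    {in U, forall x, pi (f x) = psi x} ->
  exists F : gT -> gT, [/\ {in H &, {morph F : x y / x * y}},
    {in H, forall x, F x \in H}, {in U, F =1 f}
    & {in H, forall x, pi (F x) = psi x}].
Proof.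
move=> abH sUH fM fU piM psiM im_psi pif.
have cH : abelian H := abelem_abelian abH.
have cHE x y : x \in H -> y \in H -> x * y = y * x by move=> *; apply: (centsP cH).
pose pim := Morphism piM; pose K := ('ker pim)%G.
have memK x : x \in H -> (x \in K) = (pi x == 1).
  by move=> Hx; apply/kerP/eqP.
have sKH : K \subset H by apply: subsetIl.
have [rK [rKM rKK rKid]] := abelem_retraction abH sKH.
have [rU [rUM rUU rUid]] := abelem_retraction abH sUH.
pose h x := odflt 1 [pick y in H | pi y == psi x].
have hP x : x \in H -> h x \in H /\ pi (h x) = psi x.
  move=> Hx; rewrite /h; case: pickP => [y /andP[Hy /eqP] // | no_y].
  have [y Hy piy] := im_psi x Hx; have := no_y y.
  by rewrite Hy piy eqxx.
have HK x : x \in K -> x \in H := subsetP sKH x.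
have rKH x : x \in H -> rK x \in H by move=> Hx; apply/HK/rKK.
have piV x : x \in H -> pi x^-1 = (pi x)^-1 := morphV pim (x := x).
have rKV x : x \in H -> rK x^-1 = (rK x)^-1 := morphV (Morphism rKM) (x := x).
(* [q] is a projection along the kernel [K], so [q x] depends only on [pi x] *)
pose q x := x * (rK x)^-1.
have qM : {in H &, {morph q : x y / x * y}}.
  move=> x y Hx Hy; rewrite /q rKM // invMg -!mulgA; congr (_ * _).
  by rewrite mulgA cHE ?groupM ?groupV ?rKH.
have qH x : x \in H -> q x \in H.
  by move=> Hx; rewrite groupM ?groupV ?rKH.
have piq x : x \in H -> pi (q x) = pi x.
  move=> Hx; have Kr := rKK x Hx; rewrite piM ?groupV ?rKH // piV ?rKH //.
  by move: (Kr); rewrite memK ?rKH // => /eqP->; rewrite invg1 mulg1.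
have qK x : x \in K -> q x = 1 by move=> Kx; rewrite /q rKid // mulgV.
have q_eq x y : x \in H -> y \in H -> pi x = pi y -> q x = q y.
  move=> Hx Hy eqxy; rewrite -[x](mulgKV y) qM ?groupM ?groupV //.
  by rewrite qK ?mul1g // memK ?groupM ?groupV // piM ?groupV // piV // eqxy mulgV.
(* [l] lifts [psi] through [pi]; composing with a retraction onto [U] corrects it
   to agree with [f] there. *)
pose l x := q (h x).
have lM : {in H &, {morph l : x y / x * y}}.
  move=> x y Hx Hy; have [[Hhx pix] [Hhy piy]] := (hP x Hx, hP y Hy).
  have [Hh pih] := hP _ (groupM Hx Hy).
  by rewrite /l -qM //; apply: q_eq; rewrite ?groupM // piM // pix piy pih psiM.
have lH x : x \in H -> l x \in H by move=> /hP[/qH].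
have pil x : x \in H -> pi (l x) = psi x by move=> /hP[Hh <-]; rewrite /l piq.
have UH x : x \in U -> x \in H := subsetP sUH x.
pose c u := f u * (l u)^-1.
have cM : {in U &, {morph c : x y / x * y}}.
  move=> x y Ux Uy; rewrite /c fM // lM ?UH // invMg -!mulgA; congr (_ * _).
  by rewrite mulgA cHE ?groupM ?groupV ?fU ?lH ?UH.
have cUH x : x \in U -> c x \in H.
  by move=> Ux; rewrite groupM ?groupV ?fU ?lH ?UH.
have pic x : x \in U -> pi (c x) = 1.
  by move=> Ux; rewrite piM ?groupV ?piV ?fU ?lH ?UH // pif // pil ?UH // mulgV.
exists (fun x => c (rU x) * l x); split=> [x y Hx Hy | x Hx | x Ux | x Hx].
- rewrite rUM // cM ?rUU // lM //.
  have := cHE _ _ (cUH _ (rUU _ Hy)) (lH _ Hx).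
  move: (c (rU x)) (c (rU y)) (l x) (l y) => a b u v bu.
  by rewrite -!mulgA [b * (u * v)]mulgA bu -mulgA.
- by rewrite groupM ?cUH ?rUU ?lH.
- by rewrite rUid // /c mulgKV.
by rewrite piM ?cUH ?rUU ?lH // pic ?rUU // mul1g pil.
Qed.

(** In the cyclic group of order 4, the lift is [f] if [U] is the whole group, the
   composite of [psi] with the inverse of [pi] if [pi] is injective, and the
   identity in the remaining cases, where [U] and the image of [pi] have order at
   most 2.  Unlike the elementary abelian case, this needs [f] injective and [pi]
   and [psi] to have the same kernel. *)
Lemma C4_lift H U (f : gT -> gT) (pi psi : gT -> rT) :
    cyclic H -> #|H| = 4 -> U \subset H ->
    {in U &, {morph f : x y / x * y}} -> {in U, forall x, f x \in H} ->
    {in U, forall x, f x = 1 -> x = 1} ->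
    {in H &, {morph pi : x y / x * y}} -> {in H &, {morph psi : x y / x * y}} ->
    {in H, forall x, exists2 y, y \in H & pi y = psi x} ->
    {in H, forall x, (psi x == 1) = (pi x == 1)} ->
    {in U, forall x, pi (f x) = psi x} ->
  exists F : gT -> gT, [/\ {in H &, {morph F : x y / x * y}},
    {in H, forall x, F x \in H}, {in U, F =1 f}
    & {in H, forall x, pi (F x) = psi x}].
Proof.
move=> cycH cH sUH fM fU f1 piM psiM im_psi psi1 pif.
have [eqUH | neUH] := eqVneq (U : {set gT}) H.
  have HU x : x \in H -> x \in U by rewrite eqUH.
  by exists f; split=> // [x y /HU Ux /HU Uy | x /HU/fU | x /HU/pif] //; apply: fM.
pose pim := Morphism piM; pose K := ('ker pim)%G.
have memK x : x \in H -> (x \in K) = (pi x == 1).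
  by move=> Hx; apply/kerP/eqP.
have sKH : K \subset H by apply: subsetIl.
have UH x : x \in U -> x \in H := subsetP sUH x.
(* an element of a group of order at most 2 is known from whether it is trivial *)
have small (qT : finGroupType) (A : {group qT}) x y : #|A| <= 2 -> x \in A -> y \in A ->
    (x == 1) = (y == 1) -> x = y.
  move=> cA Ax Ay; case: eqP => [-> /esym/eqP-> // | /eqP nx1 /esym/negbT ny1].
  apply: contraTeq cA => nexy; rewrite -ltnNge.
  have /subset_leq_card : [set 1; x; y] \subset A.
    by apply/subsetP=> z; rewrite !inE => /orP[/orP[]|] /eqP->.
  apply: leq_trans.
  by rewrite -setUA cardsU1 !inE negb_or eq_sym nx1 eq_sym ny1 cards2 nexy.
have cU : #|U| <= 2.
  have := cardSg sUH; have : #|U| < #|H| by rewrite proper_card // properEneq neUH.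
  by rewrite cH; case: #|U| => [|[|[|[|]]]].
have [K1 | ntK] := eqVneq (K : {set gT}) 1.
  have inj_pi : 'injm pim by apply/subsetP=> z; rewrite -K1.
  have pi_inj x y : x \in H -> y \in H -> pi x = pi y -> x = y.
    exact: (injmP inj_pi).
  pose h x := odflt 1 [pick y in H | pi y == psi x].
  have hP x : x \in H -> h x \in H /\ pi (h x) = psi x.
    move=> Hx; rewrite /h; case: pickP => [y /andP[Hy /eqP] // | no_y].
    have [y Hy piy] := im_psi x Hx; have := no_y y.
    by rewrite Hy piy eqxx.
  exists h; split=> [x y Hx Hy | x /hP[] // | x Ux | x /hP[] //].
    have [[Hhx pix] [Hhy piy]] := (hP x Hx, hP y Hy).
    have [Hh pih] := hP _ (groupM Hx Hy).
    by apply: pi_inj; rewrite ?groupM // piM // pix piy pih psiM.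
  have [Hh pih] := hP x (UH x Ux).
  by apply: pi_inj; rewrite ?fU // pih pif.
have cK : 2 <= #|K| by rewrite cardG_gt1.
exists id; split=> // [x Ux | x Hx].
  (* [U] and [f @: U] are equal, being subgroups of the same order of a cyclic
     group; the order is at most 2, so [f] fixes every element *)
  have gf : group_set (f @: U).
    have -> : f @: U = Morphism fM @* U by rewrite morphimEdom.
    exact: groupP.
  have cfU : #|f @: U| = #|U|.
    have -> : f @: U = Morphism fM @* U by rewrite morphimEdom.
    apply: card_injm => //; apply/subsetP=> y Ky; apply/set1P.
    have Uy := dom_ker Ky; apply: f1 => //; exact: (mker Ky).
  have eqU : f @: U = U.
    have sfU : f @: U \subset H by apply/subsetP=> _ /imsetP[y Uy ->]; apply: fU.
    apply/eqP; rewrite -[f @: U]/(Group gf : {set gT}).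
    by rewrite (eq_subG_cyclic cycH) //= cfU.
  apply: (small _ U) => //; first by rewrite -eqU imset_f.
  apply/eqP/eqP => [-> |]; last exact: f1.
  exact: (morph1 (Morphism fM)).
have cpi : #|pim @* H| <= 2.
  have -> : #|pim @* H| = #|H : K| by rewrite card_morphim setIid.
  rewrite -(leq_pmul2l (m := 2)) //; apply: (@leq_trans (#|K| * #|H : K|)%N).
    by rewrite leq_mul2r cK orbT.
  by rewrite Lagrange // cH.
have [y Hy piy] := im_psi x Hx.
apply: (small _ (pim @* H)%G) => //=.
- exact: (mem_morphim pim).
- by rewrite -piy; apply: (mem_morphim pim).
by rewrite psi1.
Qed.

End Lifting.

(** * Assembling primary components *)

Section Primary.
Variables (gT : finGroupType) (G : {group gT}).
Hypothesis cGG : abelian G.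
Local Notation N := #|G|.+1.

Lemma mem_pcore_abelian p x : x \in G -> (x \in 'O_p(G)) = p.-elt x.
Proof.
move=> Gx; have hall := nilpotent_pcore_Hall p (abelian_nil cGG).
by rewrite (mem_normal_Hall hall) // pcore_normal.
Qed.

Lemma constt_mem (H : {group gT}) (p : nat) x : x \in H -> x.`_p \in H.
Proof. by move=> Hx; apply: subsetP (cycle_constt p x); rewrite cycle_subG. Qed.

Lemma constt_pcore (p : nat) x : x \in G -> x.`_p \in 'O_p(G).
Proof. by move=> Gx; rewrite mem_pcore_abelian ?constt_mem // p_elt_constt. Qed.

Lemma prod_constt_bound x : x \in G -> \prod_(p < N) x.`_p = x.
Proof.
move=> Gx; rewrite -[RHS]prod_constt.
have leN : #[x].+1 <= N by rewrite ltnS dvdn_leq ?cardG_gt0 // order_dvdG.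
rewrite -(big_mkord xpredT (fun p => x.`_p)) (big_cat_nat (n := #[x].+1)) //=.
rewrite [X in _ * X]big_nat_cond [X in _ * X]big1 ?mulg1 // => p.
rewrite andbT => /andP[ltxp _]; apply/constt1P/pnatP=> // q pr_q.
move/(dvdn_leq (order_gt0 x)) => leq; rewrite !inE.
by apply: contraTneq ltxp => <-; rewrite -leqNgt.
Qed.

Lemma morph_prod_constt (rT : finGroupType) (H : {group gT}) (f : gT -> rT) x :
    H \subset G -> {in H &, {morph f : x y / x * y}} -> x \in H ->
  f x = \prod_(p < N) f x.`_p.
Proof.
move=> sHG fM Hx; rewrite -{1}(prod_constt_bound (subsetP sHG _ Hx)).
by apply: (morph_prod (Morphism fM)) => p _; apply: constt_mem.
Qed.

(** The map that acts on the [p]-part of each element by [F p].  The index [p]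
   runs over all numbers up to [#|G|], prime or not; the [p]-part is trivial when
   [p] is not prime. *)
Definition primary_prod (F : 'I_N -> gT -> gT) (x : gT) : gT :=
  \prod_(p < N) F p x.`_p.

Section Assembly.
Variable F : 'I_N -> gT -> gT.
Hypothesis FM : forall p : 'I_N, {in 'O_p(G) &, {morph F p : x y / x * y}}.
Hypothesis FG : forall p : 'I_N, {in 'O_p(G), forall x, F p x \in 'O_p(G)}.

Let FGG p x : x \in G -> F p x.`_p \in G.
Proof. by move=> Gx; apply: subsetP (pcore_sub p G) _ _; apply/FG/constt_pcore. Qed.

Lemma primary_prodM : {in G &, {morph primary_prod F : x y / x * y}}.
Proof.
move=> x y Gx Gy; rewrite /primary_prod.
elim: (index_enum _) => [|p r IHr]; first by rewrite !big_nil mulg1.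
have cxy : commute x y by apply: (centsP cGG).
rewrite !big_cons IHr consttM // FM ?constt_pcore // -!mulgA; congr (_ * _).
rewrite !mulgA; congr (_ * _); apply: (centsP cGG); first exact: FGG.
by apply: group_prod => q _; apply: FGG.
Qed.

Lemma primary_prod_mem : {in G, forall x, primary_prod F x \in G}.
Proof. by move=> x Gx; apply: group_prod => p _; apply: FGG. Qed.

Lemma primary_prod_eq (x : gT) (p : 'I_N) :
  x \in 'O_p(G) -> primary_prod F x = F p x.
Proof.
move=> Qx; have Gx := subsetP (pcore_sub p G) _ Qx.
have px : (p : nat).-elt x by rewrite -mem_pcore_abelian.
rewrite /primary_prod (eq_bigr (fun q => if q == p then F q x else 1)) => [|q _].
  by rewrite -big_mkcond big_pred1_eq.
case: eqP => [-> | /eqP neqp]; first by rewrite constt_p_elt.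
have p'x : (q : nat)^'.-elt x.
  apply: sub_in_pnat px => r _ /eqnP->; rewrite !inE.
  by rewrite eq_sym.
by rewrite (constt1P p'x); exact: (morph1 (Morphism (@FM q))).
Qed.

Lemma primary_prod_inj :
    (forall p : 'I_N, {in 'O_p(G), forall x, F p x = 1 -> x = 1}) ->
  {in G, forall x, primary_prod F x = 1 -> x = 1}.
Proof.
move=> F1 x Gx Fx1; rewrite -(prod_constt_bound Gx) big1 // => p _.
have Qx := constt_pcore p Gx; apply: (F1 p _ Qx).
rewrite -primary_prod_eq //.
by have := morph_constt (Morphism primary_prodM) p Gx; rewrite /= Fx1 constt1.
Qed.

End Assembly.
End Primary.

Section Ec.
Variables (gT : finGroupType) (G : {group gT}).
Hypothesis EG : in_Ec G.
Implicit Types (U L : {group gT}).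

(** For [p] not prime the component is trivial, hence elementary abelian. *)
Lemma Ec_pcore p : p.-abelem 'O_p(G) \/ cyclic 'O_p(G) /\ #|'O_p(G)| = 4.
Proof.
have [cGG SylG] := EG.
have [pr_p | npr_p] := boolP (prime p); last first.
  left; suff -> : 'O_p(G) = 1 by apply: abelem1.
  apply/eqP; rewrite trivg_card1; apply/eqP.
  apply: (@pnat_1 p); first exact: pcore_pgroup.
  by apply/pnatP=> // q pr_q _; rewrite !inE; apply: contraNneq npr_p => <-.
have [|abQ | isoQ] := SylG p 'O_p(G)%G pr_p.
- exact: nilpotent_pcore_Hall (abelian_nil cGG).
- by left.
right; rewrite (isog_cyclic isoQ) (card_isog isoQ) cardsT card_ord; split=> //.
by apply/cyclicP; exists Zp1; exact: (Zp_cycle 3).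
Qed.

(** A projectivity property of groups in the class: [psi] lifts through [pi] to an
   endomorphism extending the injective partial lift [f], when the image of [psi]
   is contained in that of [pi] and the two have the same kernel. *)
Lemma Ec_lift (rT : finGroupType) U (f : gT -> gT) (pi psi : gT -> rT) :
    U \subset G ->
    {in U &, {morph f : x y / x * y}} -> {in U, forall x, f x \in G} ->
    {in U, forall x, f x = 1 -> x = 1} ->
    {in G &, {morph pi : x y / x * y}} -> {in G &, {morph psi : x y / x * y}} ->
    {in G, forall x, exists2 y, y \in G & pi y = psi x} ->
    {in G, forall x, (psi x == 1) = (pi x == 1)} ->
    {in U, forall x, pi (f x) = psi x} ->
  exists F : gT -> gT, [/\ {in G &, {morph F : x y / x * y}},
    {in G, forall x, F x \in G}, {in U, F =1 f}
    & {in G, forall x, pi (F x) = psi x}].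
Proof.
move=> sUG fM fU f1 piM psiM im_psi psi1 pif; have [cGG _] := EG.
have QG (p : nat) x : x \in 'O_p(G) -> x \in G := subsetP (pcore_sub p G) x.
have ex_F (p : 'I_(#|G|.+1)) : exists F : gT -> gT,
    [/\ {in 'O_p(G) &, {morph F : x y / x * y}},
      {in 'O_p(G), forall x, F x \in 'O_p(G)}, {in U :&: 'O_p(G), F =1 f}
      & {in 'O_p(G), forall x, pi (F x) = psi x}].
  have sUQ : U :&: 'O_p(G) \subset 'O_p(G) by apply: subsetIr.
  have fM' : {in U :&: 'O_p(G) &, {morph f : x y / x * y}}.
    by move=> x y /setIP[Ux _] /setIP[Uy _]; apply: fM.
  have fU' : {in U :&: 'O_p(G), forall x, f x \in 'O_p(G)}.
    move=> x /setIP[Ux Qx]; rewrite mem_pcore_abelian ?fU //.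
    have px : (p : nat).-elt x by rewrite -(mem_pcore_abelian cGG) //; exact: QG Qx.
    exact: (morph_p_elt (Morphism fM)).
  have f1' : {in U :&: 'O_p(G), forall x, f x = 1 -> x = 1}.
    by move=> x /setIP[Ux _]; apply: f1.
  have piM' : {in 'O_p(G) &, {morph pi : x y / x * y}}.
    by move=> x y /QG Gx /QG Gy; apply: piM.
  have psiM' : {in 'O_p(G) &, {morph psi : x y / x * y}}.
    by move=> x y /QG Gx /QG Gy; apply: psiM.
  have im_psi' : {in 'O_p(G), forall x, exists2 y, y \in 'O_p(G) & pi y = psi x}.
    move=> x Qx; have Gx := QG _ _ Qx; have [y Gy piy] := im_psi x Gx.
    exists y.`_p; first exact: constt_pcore.
    have px : (p : nat).-elt x by rewrite -(mem_pcore_abelian cGG).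
    rewrite -[in RHS](constt_p_elt px).
    have piC : pi y.`_p = (pi y).`_p := morph_constt (Morphism piM) p Gy.
    have psiC : psi x.`_p = (psi x).`_p := morph_constt (Morphism psiM) p Gx.
    by rewrite piC piy psiC.
  have psi1' : {in 'O_p(G), forall x, (psi x == 1) = (pi x == 1)}.
    by move=> x /QG; apply: psi1.
  have pif' : {in U :&: 'O_p(G), forall x, pi (f x) = psi x}.
    by move=> x /setIP[Ux _]; apply: pif.
  have [abQ | [cycQ cQ]] := Ec_pcore p.
    exact: (abelem_lift abQ sUQ).
  exact: (C4_lift cycQ cQ sUQ).
have [F FP] := fin_all_exists ex_F.
have FM (p : 'I_(#|G|.+1)) : {in 'O_p(G) &, {morph F p : x y / x * y}} by have [] := FP p.
have FQ (p : 'I_(#|G|.+1)) : {in 'O_p(G), forall x, F p x \in 'O_p(G)} by have [] := FP p.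
exists (primary_prod F); split.
- exact: primary_prodM.
- exact: primary_prod_mem.
- move=> x Ux; rewrite (morph_prod_constt sUG fM Ux).
  apply: eq_bigr => p _; have [_ _ Ff _] := FP p; apply: Ff.
  by rewrite inE constt_mem //= constt_pcore // (subsetP sUG).
move=> x Gx; rewrite (morph_prod_constt (subxx G) psiM Gx) /primary_prod.
transitivity (\prod_(p < #|G|.+1) pi (F p x.`_p)); last first.
  by apply: eq_bigr => p _; have [_ _ _ piF] := FP p; rewrite piF ?constt_pcore.
by apply: (morph_prod (Morphism piM)) => p _; apply/QG/FQ/constt_pcore.
Qed.

(** Chains [L' <= U'] and [L <= U] of subgroups of the same orders correspond
   under an automorphism of [G], given here as an injective endomorphism. *)
Lemma Ec_transitive U L U' L' :
    L \subset U -> U \subset G -> L' \subset U' -> U' \subset G ->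
    #|L| = #|L'| -> #|U| = #|U'| ->
  exists F : gT -> gT, [/\ {in G &, {morph F : x y / x * y}},
    {in G, forall x, F x \in G}, {in G, forall x, F x = 1 -> x = 1},
    {in L, forall x, F x \in L'} & {in U, forall x, F x \in U'}].
Proof.
move=> sLU sUG sLU' sUG' cL cU; have [cGG _] := EG.
have card_pcore (p : nat) (A A' : {group gT}) : A \subset G -> A' \subset G ->
    #|A| = #|A'| -> #|A :&: 'O_p(G)| = #|A' :&: 'O_p(G)|.
  move=> sAG sAG' cA; have hall := nilpotent_pcore_Hall p (abelian_nil cGG).
  have nAG : 'O_p(G) <| G by apply: pcore_normal.
  rewrite ![_ :&: 'O_p(G)]setIC.
  by rewrite !(card_Hall (setI_normal_Hall nAG hall _)) ?cA.
have ex_F (p : 'I_(#|G|.+1)) : exists F : gT -> gT,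
    [/\ {in 'O_p(G) &, {morph F : x y / x * y}},
      {in 'O_p(G), forall x, F x \in 'O_p(G)},
      {in 'O_p(G), forall x, F x = 1 -> x = 1},
      {in L :&: 'O_p(G), forall x, F x \in L'}
      & {in U :&: 'O_p(G), forall x, F x \in U'}].
  have cpL := card_pcore p L L' (subset_trans sLU sUG) (subset_trans sLU' sUG') cL.
  have cpU := card_pcore p U U' sUG sUG' cU.
  have [abQ | [cycQ cQ]] := Ec_pcore p; last first.
    have eqI (A A' : {group gT}) : #|A :&: 'O_p(G)| = #|A' :&: 'O_p(G)| ->
        {in A :&: 'O_p(G), forall x, x \in A'}.
      move=> cA x Ax; suff: x \in A' :&: 'O_p(G) by case/setIP.
      suff /eqP <- : A :&: 'O_p(G) == A' :&: 'O_p(G) by [].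
      by rewrite (eq_subG_cyclic cycQ) ?subsetIr // cA.
    by exists id; split=> //; apply: eqI.
  have abI (A : {group gT}) : p.-abelem (A :&: 'O_p(G)).
    by apply: abelemS abQ; apply: subsetIr.
  have sI (A B : {group gT}) : A \subset B -> A :&: 'O_p(G) \subset B :&: 'O_p(G).
    exact: setSI.
  (* extend along 1 <= L <= U <= 'O_p(G), starting from the identity of 1 *)
  have [|||f0 [f0M f0L f01 _]] := @abelem_iso_ext _ p (L :&: 'O_p(G)) (L' :&: 'O_p(G))
    1 1 id (abI L) (abI L') cpL (sub1G _) (sub1G _) erefl.
  - by [].
  - by [].
  - by [].
  have [f1 [f1M f1U f11 f1f0]] := @abelem_iso_ext _ p (U :&: 'O_p(G)) (U' :&: 'O_p(G))
    (L :&: 'O_p(G)) (L' :&: 'O_p(G)) f0 (abI U) (abI U') cpU (sI _ _ sLU)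
    (sI _ _ sLU') cpL f0M f0L f01.
  have [F [FM FQ F1 Ff1]] := @abelem_iso_ext _ p 'O_p(G) 'O_p(G)
    (U :&: 'O_p(G)) (U' :&: 'O_p(G)) f1 abQ abQ erefl (subsetIr _ _)
    (subsetIr _ _) cpU f1M f1U f11.
  exists F; split=> // x => [Lx | Ux]; last first.
    by rewrite Ff1 //; have /setIP[] := f1U _ Ux.
  rewrite Ff1 ?(subsetP (sI _ _ sLU)) // f1f0 //.
  by have /setIP[] := f0L _ Lx.
have [F FP] := fin_all_exists ex_F.
have FM (p : 'I_(#|G|.+1)) : {in 'O_p(G) &, {morph F p : x y / x * y}} by have [] := FP p.
have FQ (p : 'I_(#|G|.+1)) : {in 'O_p(G), forall x, F p x \in 'O_p(G)} by have [] := FP p.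
have F1 (p : 'I_(#|G|.+1)) : {in 'O_p(G), forall x, F p x = 1 -> x = 1} by have [] := FP p.
exists (primary_prod F); split.
- exact: primary_prodM.
- exact: primary_prod_mem.
- exact: primary_prod_inj.
- move=> x Lx; apply: group_prod => p _; have [_ _ _ FL _] := FP p; apply: FL.
  by rewrite inE constt_mem ?constt_pcore // (subsetP sUG) // (subsetP sLU).
move=> x Ux; apply: group_prod => p _; have [_ _ _ _ FU] := FP p; apply: FU.
by rewrite inE constt_mem ?constt_pcore // (subsetP sUG).
Qed.

End Ec.

Lemma Aut_of_fun (gT : finGroupType) (G : {group gT}) (F : gT -> gT) :
    {in G &, {morph F : x y / x * y}} -> {in G, forall x, F x \in G} ->
    {in G, forall x, F x = 1 -> x = 1} ->
  exists2 s, s \in Aut G & {in G, s =1 F}.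
Proof.
move=> FM FG F1; pose Fm := Morphism FM.
have injF : 'injm Fm.
  by apply/subsetP=> x Kx; apply/set1P/F1; [apply: dom_ker Kx | apply: (mker Kx)].
have FGG : Fm @* G = G.
  apply/eqP; rewrite eqEcard card_injm // leqnn andbT.
  by apply/subsetP=> _ /morphimP[x _ Gx ->]; apply: FG.
by exists (aut injF FGG); [apply: Aut_aut | apply: autE].
Qed.

(** * The generalized wreath product *)

Section Core.
Variables (gT : finGroupType) (G : {group gT}) (P : {set {set gT}}).
Variables (U L : {group gT}).
Implicit Types (X : {set gT}) (f phi : {perm gT}).

Lemma AutG_fix (rT : finGroupType) (H : {group rT}) (Q : {set {set rT}})
    (a : {perm rT}) (X : {set rT}) :
  a \in AutG H Q -> X \in Q -> a @: X = X.
Proof.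
case/setIP=> /AutSrP[_ aQ] Aa QX.
apply/eqP; rewrite eqEcard card_imset ?leqnn ?andbT; last exact: perm_inj.
apply/subsetP=> _ /imsetP[x Xx ->].
by have := aQ X QX x 1 Xx (group1 H); rewrite (Aut_fix1 Aa) invg1 !mulg1.
Qed.

Lemma AutG_intro (rT : finGroupType) (H : {group rT}) (Q : {set {set rT}})
    (a : {perm rT}) : {in Q, forall X : {set rT}, X \subset H} ->
  a \in Aut H -> {in Q, forall X : {set rT}, a @: X = X} -> a \in AutG H Q.
Proof.
move=> sQH Aa aQ; have [onH aM] := Aut_onP Aa; apply/setIP; split=> //.
apply/AutSrP; split=> // X QX x g Xx Hg.
have Hx := subsetP (sQH X QX) _ Xx.
by rewrite aM // mulgK -(aQ X QX) imset_f.
Qed.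

Lemma perm_fix_inv (T : finType) (a : {perm T}) (X : {set T}) :
  a @: X = X -> a^-1 @: X = X.
Proof. by move=> aX; rewrite -{1}aX imset_permK. Qed.

Hypothesis EG : in_Ec G.
Hypothesis SP : is_Sring G P.
Hypothesis secUL : is_Asection G P U L.
Hypothesis wrP : is_wreath G P U L.
Hypothesis CIU : is_CI U (Sring_sub P U).
Hypothesis CIL : is_CI (G / L) (Sring_sec P G L).
(* Each of the three conditions of the theorem yields this decomposition of the
   elements of [Aut_S(A_S)], possibly with [a] or [b] trivial. *)
Hypothesis decomp : {in AutG (U / L) (Sring_sec P U L), forall s : {perm coset_of L},
  exists a b, [/\ a \in AutG U (Sring_sub P U),
    b \in AutG (G / L) (Sring_sec P G L), b @: (U / L) = U / L
    & {in U, forall x, s (coset L x) = b (coset L (a x))}]}.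

(** The CI criterion for isomorphisms preserving both [U] and [L]. *)
Lemma wreath_automorphism f : normal_iso G P f -> f @: U = U -> f @: L = L ->
  exists2 phi, phi \in Aut G & {in P, forall X, phi @: X = f @: X}.
Proof.
move=> nf fU fL; have [nLU' AU AL] := secUL; have [nLG' wrX] := wrP.
have nLG := normal_norm nLG'; have nLU := normal_norm nLU'; have sLU := normal_sub nLU'.
have [partP _ _ _] := SP; have [onG f1 Sf fP] := nf.
have [sUG cU] := (AsubgroupE _ partP).1 AU.
have [sLG cL] := (AsubgroupE _ partP).1 AL.
have Gf y : (f y \in G) = (y \in G) by apply: perm_closed.
have sPG X : X \in P -> X \subset G by apply: partition_sub.
have sfG X : X \subset G -> f @: X \subset G.
  by move=> sXG; rewrite -(imset_perm_on onG) imsetS.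
have sfU X : X \subset U -> f @: X \subset U by move=> sXU; rewrite -fU imsetS.
have UG x : x \in U -> x \in G := subsetP sUG x.
(* the automorphisms of [U] and [G / L] provided by the CI property *)
have [phi1 A1 phi1P] := CI_normal_iso CIU (normal_iso_restr partP AU nf fU).
have {}phi1P X : X \in P -> X \subset U -> phi1 @: X = f @: X.
  by move=> PX sXU; rewrite phi1P ?restr_perm_imset // inE PX.
have [fq nfq fqE] := normal_iso_quotient SP AL nLG nf fL.
have [phi2 A2 phi2P] := CI_normal_iso CIL nfq.
have {}phi2P X : X \in P -> phi2 @: (X / L) = f @: X / L.
  move=> PX; rewrite phi2P; last by apply: imset_f; rewrite inE PX sPG.
  by apply: (quotient_imset nLG fqE); [apply: sPG | apply/sfG/sPG].
have [on1 M1] := Aut_onP A1; have [on2 M2] := Aut_onP A2.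
have phi1U x : x \in U -> phi1 x \in U by rewrite (perm_closed _ on1).
have phi1L x : x \in U -> (phi1 x \in L) = (x \in L).
  move=> Ux; suff imL : phi1 @: L = L by rewrite -{1}imL (mem_imset _ _ (@perm_inj _ phi1)).
  apply/eqP; rewrite eqEcard card_imset ?leqnn ?andbT; last exact: perm_inj.
  apply/subsetP=> _ /imsetP[l Ll ->].
  have [X PX Xl] := partition_block partP (subsetP sLG _ Ll).
  have sXL : X \subset L := cL X PX l Xl Ll.
  rewrite -fL; apply: (subsetP (imsetS f sXL)).
  by rewrite -phi1P ?imset_f // (subset_trans sXL).
have phi2U : phi2 @: (U / L) = U / L.
  apply/eqP; rewrite eqEcard (card_imset _ (@perm_inj _ phi2)) leqnn andbT.
  apply/subsetP=> _ /imsetP[_ /(mem_quo_group nLU)[u Uu ->] ->].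
  have [X PX Xu] := partition_block partP (UG _ Uu).
  have sXU : X \subset U := cU X PX u Xu Uu.
  apply: (subsetP (quotientS L (sfU _ sXU))); rewrite -phi2P // imset_f //.
  by apply/(quoP nLU _ sXU); exists u.
have UqG : U / L \subset G / L by apply: quotientS.
(* the automorphism of [U / L] comparing the two *)
have compat1 : {in U &, forall x y,
    (coset L (phi1 x) == coset L (phi1 y)) = (coset L x == coset L y)}.
  move=> x y Ux Uy /=; rewrite !(coset_eq_quo nLU) ?phi1U // -(phi1L (x * y^-1)); last first.
    by rewrite groupM ?groupV.
  by rewrite M1 ?groupV // (Aut_morphV A1).
have [h1 onh1 h1E] := quotient_perm nLU phi1U compat1.
pose r2 := restr_perm (U / L) phi2.
have r2E c : c \in U / L -> r2 c = phi2 c.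
  move=> Uc; rewrite /r2 restr_permE //; apply/astabsP=> d /=.
  by rewrite apermE -{1}phi2U (mem_imset _ _ (@perm_inj _ phi2)).
have Ah1 : h1 \in Aut (U / L).
  rewrite inE onh1; apply/morphicP=> _ d /(mem_quo_group nLU)[x Ux ->].
  case/(mem_quo_group nLU)=> y Uy ->{d}.
  rewrite -(cosetM_quo nLU) // !h1E ?groupM // M1 //.
  by rewrite (cosetM_quo nLU) ?phi1U.
have Ar2 : r2 \in Aut (U / L).
  rewrite inE restr_perm_on; apply/morphicP=> c d Uc Ud.
  by rewrite !r2E ?groupM // M2 // (subsetP UqG).
have As : h1 * r2^-1 \in AutG (U / L) (Sring_sec P U L).
  apply: AutG_intro => [_ /imsetP[X + ->] | | _ /imsetP[X + ->]].
  - by rewrite inE => /andP[_ sXU]; apply: quotientS.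
  - by rewrite groupM ?groupV.
  rewrite inE => /andP[PX sXU].
  have h1X : h1 @: (X / L) = f @: X / L.
    rewrite -phi1P //; apply: (quotient_imset nLU h1E sXU).
    by rewrite (phi1P X PX sXU) sfU.
  have r2X : r2 @: (X / L) = f @: X / L.
    by rewrite restr_perm_imset ?(phi2P X PX) ?quotientS.
  by rewrite imset_permM h1X -r2X imset_permK.
have [a [b [Aa Ab bU sE]]] := decomp As.
have [_ AaU] := setIP Aa; have [_ AbG] := setIP Ab.
have [ona aM] := Aut_onP AaU; have [onb bM] := Aut_onP AbG.
(* adjusting by [a] and [b] makes the two automorphisms agree on [U / L] *)
pose g1 := a^-1 * phi1; pose g2 := b * phi2.
have Ag1 : g1 \in Aut U by rewrite groupM ?groupV.
have Ag2 : g2 \in Aut (G / L) by rewrite groupM.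
have [ong1 g1M] := Aut_onP Ag1; have [ong2 g2M] := Aut_onP Ag2.
have aVU x : x \in U -> a^-1 x \in U.
  by move=> Ux; rewrite (perm_closed _ (perm_onV ona)).
have g12 : {in U, forall x, coset L (g1 x) = g2 (coset L x)}.
  move=> y Uy; rewrite /g1 /g2 !permM -h1E ?aVU //.
  have := sE _ (aVU _ Uy); rewrite permKV permM => /(congr1 r2).
  rewrite permKV => ->; apply: r2E.
  by rewrite -bU imset_f // mem_quotient.
have g1U x : x \in U -> g1 x \in U by rewrite (perm_closed _ ong1).
have g2G c : c \in G / L -> g2 c \in G / L by rewrite (perm_closed _ ong2).
have g1X X : X \in P -> X \subset U -> g1 @: X = f @: X.
  move=> PX sXU; rewrite imset_permM perm_fix_inv ?phi1P //; apply: AutG_fix Aa _.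
  by rewrite inE PX.
have g2X X : X \in P -> g2 @: (X / L) = f @: X / L.
  move=> PX; rewrite imset_permM (AutG_fix Ab) ?phi2P //; apply: imset_f; rewrite inE PX sPG //.
have g2_eq1 c : (g2 c == 1) = (c == 1).
  by rewrite -{1}(Aut_fix1 Ag2) (inj_eq (@perm_inj _ g2)).
have [||||||||F [FM FG Fg1 Fg2]] := @Ec_lift _ _ EG _ U g1 (coset L)
    (fun x => g2 (coset L x)) sUG.
- exact: g1M.
- by move=> x /g1U/UG.
- by move=> x _ g1x; apply: (@perm_inj _ g1); rewrite g1x (Aut_fix1 Ag1).
- exact: cosetM_quo nLG.
- by move=> x y Gx Gy; rewrite (cosetM_quo nLG) // g2M ?mem_quotient.
- move=> x Gx; have := g2G _ (mem_quotient L Gx).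
  by case/(mem_quo_group nLG)=> y Gy ->; exists y.
- by move=> x Gx; rewrite g2_eq1.
- exact: g12.
have F1 : {in G, forall x, F x = 1 -> x = 1}.
  move=> x Gx Fx1; have := Fg2 x Gx; rewrite Fx1 morph1 => /esym/eqP.
  rewrite g2_eq1 => /eqP Lx1.
  have Lx : x \in L by rewrite -(invgK x) groupV -[x^-1]mul1g -(coset_eq_quo nLG) // morph1 Lx1.
  have Ux := subsetP sLU _ Lx.
  by move: Fx1; rewrite Fg1 // => g1x; apply: (@perm_inj _ g1); rewrite g1x (Aut_fix1 Ag1).
have [phi Aphi phiE] := Aut_of_fun FM FG F1.
exists phi => // X PX; have sXG := sPG X PX.
have [sXU | nsXU] := boolP (X \subset U).
  rewrite -g1X //; apply: eq_in_imset => x Xx.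
  by rewrite phiE ?(subsetP sXG) // Fg1 ?(subsetP sXU).
have sXGU : X \subset G :\: U.
  apply/subsetP=> x Xx; rewrite inE (subsetP sXG) // andbT.
  by apply: contra nsXU; apply: cU Xx.
apply/eqP; rewrite eqEcard !card_imset ?leqnn ?andbT; try exact: perm_inj.
apply/subsetP=> _ /imsetP[x Xx ->]; have Gx := subsetP sXG _ Xx.
rewrite phiE //.
(* [f @: X] is a union of [L]-cosets, so membership can be tested modulo [L] *)
have: F x \in (f @: X) * L.
  rewrite -(mem_quo nLG) ?sfG ?FG // Fg2 // -g2X // imset_f //.
  by apply/(quoP nLG _ sXG); exists x.
case/mulsgP=> _ l /imsetP[z Xz ->] Ll ->; have Gz := subsetP sXG _ Xz.
have cGG := EG.1; have Gl := subsetP sLG _ Ll.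
rewrite ((centsP cGG) _ _ _ Gl) ?Gf //.
have: l * f z \in f @: (L :* z).
  by rewrite (normal_iso_rcoset AL nf) // fL mem_rcoset mulgK.
apply: subsetP; apply: imsetS; apply/subsetP=> _ /rcosetP[k Lk ->].
have := subsetP (wrX X PX sXGU) _ Lk; rewrite inE => /and3P[_ /eqP kX _].
by rewrite -kX mem_lcoset mulKg.
Qed.

Lemma wreath_CI : is_CI G P.
Proof.
have [partP _ _ _] := SP; have [nLU AU AL] := secUL.
apply: CI_intro => // f nf.
have [U' defU' [sUG' _]] := normal_iso_subgroup partP AU nf.
have [L' defL' [sLG' _]] := normal_iso_subgroup partP AL nf.
have sLU := normal_sub nLU; have [sUG _] := AU.
have sLU' : L' \subset U' by rewrite defL' defU' imsetS.
have cU : #|U'| = #|U| by rewrite defU' card_imset //; apply: perm_inj.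
have cL : #|L'| = #|L| by rewrite defL' card_imset //; apply: perm_inj.
have [F [FM FG F1 FL FU]] := Ec_transitive EG sLU' sUG' sLU sUG cL cU.
have [s As sE] := Aut_of_fun FM FG F1.
have im_s (A A' : {group gT}) : A' = f @: A :> {set gT} -> A' \subset G ->
    #|A'| = #|A| -> {in A', forall x, F x \in A} -> (f * s)%g @: A = A.
  move=> defA' sAG' cA FA; apply/eqP; rewrite imset_permM -defA' eqEcard.
  rewrite card_imset ?cA ?leqnn ?andbT; last exact: perm_inj.
  by apply/subsetP=> _ /imsetP[x Ax ->]; rewrite sE ?FA // (subsetP sAG').
have [phi Aphi phiP] := wreath_automorphism (normal_iso_Aut nf As)
  (im_s _ _ defU' sUG' cU FU) (im_s _ _ defL' sLG' cL FL).
exists (phi * s^-1) => [|X PX]; first by rewrite groupM ?groupV.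
by rewrite imset_permM phiP // imset_permM imset_permK.
Qed.

End Core.

Theorem lemma5p3 (gT : finGroupType) (G : {group gT}) (P : {set {set gT}})
    (U L : {group gT}) :
  in_Ec G ->
  is_Sring G P ->
  is_Asection G P U L ->
  is_nontrivial_wreath G P U L ->
  is_CI U (Sring_sub P U) ->
  is_CI (G / L) (Sring_sec P G L) ->
  (AutG (U / L) (Sring_sec P U L) =
     sec_perms U L (AutG U (Sring_sub P U)) *
     sub_perms (U / L) (AutG (G / L) (Sring_sec P G L)) ->
   is_CI G P) /\
  (AutG (U / L) (Sring_sec P U L) = sec_perms U L (AutG U (Sring_sub P U)) \/
   AutG (U / L) (Sring_sec P U L) =
     sub_perms (U / L) (AutG (G / L) (Sring_sec P G L)) ->
   is_CI G P).
Proof.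
move=> EG SP secUL [wrP _ _] CIU CIL; have [nLU AU _] := secUL.
have CI := wreath_CI EG SP secUL wrP CIU CIL.
have nLUn := normal_norm nLU.
have id_aut (rT : finGroupType) (H : {group rT}) (Q : {set {set rT}}) :
    {in Q, forall X : {set rT}, X \subset H} -> 1 \in AutG H Q.
  move=> sQH; apply: AutG_intro => // X _.
  by rewrite -[RHS]imset_id; apply: eq_imset => x; rewrite perm1.
have id1 : 1 \in AutG U (Sring_sub P U).
  by apply: id_aut => X; rewrite inE => /andP[].
have id2 : 1 \in AutG (G / L) (Sring_sec P G L).
  by apply: id_aut => _ /imsetP[X + ->]; rewrite inE => /andP[_]; apply: quotientS.
have id2U : (1 : {perm coset_of L}) @: (U / L) = U / L.
  by rewrite -[RHS]imset_id; apply: eq_imset => x; rewrite perm1.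
have secE h : h \in sec_perms U L (AutG U (Sring_sub P U)) ->
    exists2 a, a \in AutG U (Sring_sub P U)
      & {in U, forall x, h (coset L x) = coset L (a x)}.
  rewrite inE => /andP[_ /existsP[a /andP[Aa /andP[_ /'forall_implyP ha]]]].
  by exists a => // x Ux; apply/eqP/ha.
have subE k : k \in sub_perms (U / L) (AutG (G / L) (Sring_sec P G L)) ->
    exists b, [/\ b \in AutG (G / L) (Sring_sec P G L), b @: (U / L) = U / L
      & {in U / L, k =1 b}].
  case/imsetP=> b; rewrite inE => /andP[Ab /eqP bU] ->; exists b; split=> // c Uc.
  rewrite restr_permE //; apply/astabsP=> d /=.
  by rewrite apermE -{1}bU (mem_imset _ _ (@perm_inj _ b)).
split=> [dec | [dec | dec]]; apply: CI => s; rewrite dec.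
- case/mulsgP=> h k /secE[a Aa ha] /subE[b [Ab bU kb]] ->.
  exists a, b; split=> // x Ux; rewrite permM ha // kb //.
  have [_ /Aut_onP[ona _]] := setIP Aa.
  by rewrite mem_quotient // (perm_closed _ ona).
- case/secE=> a Aa ha; exists a, 1; split=> // x Ux.
  by rewrite perm1 ha.
case/subE=> b [Ab bU sb]; exists 1, b; split=> // x Ux.
by rewrite perm1 sb // mem_quotient.
Qed.
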